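(* Let $E\subset\mathbb R^d$ be a non-singleton self-similar attractor, i.e. the unique nonempty compact set with $E=\bigcup_{i\in I}S_i(E)$ for some finite family $(S_i)_{i\in I}$ of contracting similarities of $\mathbb R^d$ (no separation condition is assumed). Then $s:=\dim_{\mathrm H}E=\dim_{\mathrm P}E>0$, and for every finite $\delta>0$, $$\mathcal M^s_\infty(E)=\mathcal M^s_\delta(E)=\mathcal M^s(E)<\infty.$$
   Context: A contracting similarity of $\mathbb R^d$ has ratio in $(0,1)$. $\dim_{\mathrm H}$, $\dim_{\mathrm P}$ are Hausdorff and packing dimension. Labelled packing quantities on $\mathbb R^d$ (Euclidean metric). $|E|$ is the diameter, $|\varnothing|=0$. For $s>0$, nonempty $E\subset\mathbb R^d$ and $0<R<\infty$ with $|E|\le R$, $$\Phi^s(E,R):=\sup\Big\{\sum_{i=1}^N(2r_i)^s: N\ge1,\ x_i\in\overline E,\ 0<r_i\le R,\ |x_i-x_j|\ge r_i+r_j\ (i\ne j)\Big\},$$ and $\Phi^s(\varnothing,R):=0$. For $0<\delta<\infty$, $$\mathcal M^s_\delta(F):=\inf\Big\{\sum_{j=1}^\infty\Phi^s(E_j,R_j):F\subseteq\bigcup_{j}E_j,\ |E_j|\le R_j\le\delta,\ R_j>0\Big\},$$ $\mathcal M^s(F):=\lim_{\delta\downarrow0}\mathcal M^s_\delta(F)=\sup_{0<\delta<1}\mathcal M^s_\delta(F)$, and $$\mathcal M^s_\infty(F):=\inf\Big\{\sum_j\Phi^s(E_j,R_j):F\subseteq\bigcup_jE_j,\ |E_j|\le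 R_j,\ 0<R_j<\infty\Big\}$$ (countable covers). *)

(* Defs.v *)
From mathcomp Require Import all_boot all_order all_algebra.
From mathcomp Require Import all_classical all_reals all_analysis.
Import Order.TTheory GRing.Theory Num.Theory.
Import numFieldNormedType.Exports.

Set Implicit Arguments.
Unset Strict Implicit.
Unset Printing Implicit Defensive.

Local Open Scope classical_set_scope.
Local Open Scope ring_scope.

Section euclidean.
Context {R : realType} {d : nat}.
Implicit Types (x y : 'rV[R]_d) (A : set 'rV[R]_d).

(* The library norm on row vectors is the sup norm, hence a separate
   Euclidean distance.  The library topology on row vectors is nevertheless
   the Euclidean one ([nbhs_eballP] below), so the library's [compact] and
   [closure] are the usual notions on R^d. *)
Definition eucl_dist x y : R := Num.sqrt (\sum_i (x 0 i - y 0 i) ^+ 2).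

Definition closed_eball x (r : R) : set 'rV[R]_d := [set y | eucl_dist x y <= r].

Lemma nbhs_eballP x A :
  nbhs x A <-> exists2 e : R, 0 < e & [set y | eucl_dist x y < e] `<=` A.
Proof.
split.
- move=> /nbhs_ballP[e /= e0 eA]; exists e => // y /= xye; apply: eA.
  split => // i j; rewrite [i]ord1 /ball /=; apply: le_lt_trans xye.
  rewrite -sqrtr_sqr ler_sqrt ?sqr_ge0//.
    by rewrite (bigD1 j)//= lerDl sumr_ge0// => k _; exact: sqr_ge0.
  by rewrite sumr_ge0// => k _; exact: sqr_ge0.
- move=> [e e0 eA]; apply/nbhs_ballP.
  have D0 : 0 < d.+1%:R :> R by rewrite ltr0n.
  exists (e / d.+1%:R) => /=; first exact: divr_gt0.
  move=> y [_ xy]; apply: eA => /=.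
  rewrite -(ger0_norm (ltW e0)) -sqrtr_sqr /eucl_dist ltr_sqrt ?exprn_gt0//.
  apply: (@le_lt_trans _ _ (\sum_(i < d) (e / d.+1%:R) ^+ 2)).
    apply: ler_sum => i _; have := xy 0 i; rewrite /ball /= => xyi.
    rewrite -real_normK ?num_real// lerXn2r ?nnegrE//; last exact: ltW.
    by rewrite ltW// divr_gt0.
  rewrite sumr_const card_ord expr_div_n -[ltLHS]mulr_natr -mulrA gtr_pMr ?exprn_gt0//.
  rewrite mulrC ltr_pdivrMr ?exprn_gt0// mul1r -natrX ltr_nat.
  by rewrite expnS expn1 (@leq_trans d.+1)// leq_pmulr.
Qed.

(* Values in [\bar R]; the maximum with 0 only matters for the empty set. *)
Definition diam A : \bar R :=
  maxe 0%E (ereal_sup [set (eucl_dist x y)%:E | x in A & y in A]).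

Definition contracting_similarity (f : 'rV[R]_d -> 'rV[R]_d) : Prop :=
  exists2 c : R, 0 < c < 1 & forall x y, eucl_dist (f x) (f y) = c * eucl_dist x y.

(* By Hutchinson's theorem there is exactly one such set [E] when the index
   type is nonempty and every [S i] is a contracting similarity; [E !=set0]
   forces the index type to be nonempty. *)
Definition is_attractor (I : finType) (S : I -> 'rV[R]_d -> 'rV[R]_d)
    (E : set 'rV[R]_d) : Prop :=
  [/\ E !=set0, compact E & E = \bigcup_(i in [set: I]) (S i @` E)].

End euclidean.

(* In all the definitions below the exponent [s] is meant to be positive. *)

Section hausdorff_dimension.
Context {R : realType} {d : nat}.
Implicit Types (s delta : R) (F : set 'rV[R]_d).
Local Open Scope ereal_scope.

Definition hausdorff_premeasure s delta F : \bar R :=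
  ereal_inf [set v | exists U : nat -> set 'rV[R]_d,
    [/\ F `<=` \bigcup_j U j, (forall j, diam (U j) <= delta%:E) &
        v = \sum_(0 <= j <oo) (diam (U j) `^ s)]].

Definition hausdorff_measure s F : \bar R :=
  ereal_sup [set hausdorff_premeasure s delta F | delta in [set t : R | (0 < t)%R]].

Definition dimH F : \bar R :=
  ereal_inf [set s%:E | s in [set s : R | (0 < s)%R /\ hausdorff_measure s F = 0]].

End hausdorff_dimension.

Section packing_dimension.
Context {R : realType} {d : nat}.
Implicit Types (s delta : R) (F : set 'rV[R]_d).
Local Open Scope ereal_scope.

(* Finite packings suffice in the supremum; N = 0 gives 0 on the empty set. *)
Definition packing_content s delta F : \bar R :=
  ereal_sup [set v | exists (N : nat) (x : 'I_N -> 'rV[R]_d) (r : 'I_N -> R),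
    [/\ (forall i, F (x i)), (forall i, (0 < r i <= delta)%R),
        (forall i j, i != j ->
           closed_eball (x i) (r i) `&` closed_eball (x j) (r j) = set0) &
        v = (\sum_(i < N) (2 * r i) `^ s)%R%:E]].

Definition packing_premeasure s F : \bar R :=
  ereal_inf [set packing_content s delta F | delta in [set t : R | (0 < t)%R]].

Definition packing_measure s F : \bar R :=
  ereal_inf [set v | exists A : nat -> set 'rV[R]_d,
    F `<=` \bigcup_j A j /\ v = \sum_(0 <= j <oo) packing_premeasure s (A j)].

Definition dimP F : \bar R :=
  ereal_inf [set s%:E | s in [set s : R | (0 < s)%R /\ packing_measure s F = 0]].

End packing_dimension.

Section labelled_packing.
Context {R : realType} {d : nat}.
Implicit Types (s delta : R) (E F : set 'rV[R]_d).
Local Open Scope ereal_scope.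

Definition Phi s E (rho : R) : \bar R :=
  if E == set0 then 0 else
  ereal_sup [set v | exists (N : nat) (x : 'I_N -> 'rV[R]_d) (r : 'I_N -> R),
    [/\ (0 < N)%N, (forall i, closure E (x i)), (forall i, (0 < r i <= rho)%R),
        (forall i j, i != j -> (r i + r j <= eucl_dist (x i) (x j))%R) &
        v = (\sum_(i < N) (2 * r i) `^ s)%R%:E]].

Definition labelled_cover F (A : nat -> set 'rV[R]_d) (rho : nat -> R) : Prop :=
  F `<=` \bigcup_j A j /\ forall j, (0 < rho j)%R /\ diam (A j) <= (rho j)%:E.

Definition Mdelta s delta F : \bar R :=
  ereal_inf [set v | exists A rho,
    [/\ labelled_cover F A rho, (forall j, (rho j <= delta)%R) &
        v = \sum_(0 <= j <oo) Phi s (A j) (rho j)]].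

Definition Minfty s F : \bar R :=
  ereal_inf [set v | exists A rho,
    labelled_cover F A rho /\ v = \sum_(0 <= j <oo) Phi s (A j) (rho j)].

Definition Mlim s F : \bar R := lim (Mdelta s delta F @[delta --> 0^'+]).

Lemma Mdelta_anti s F (a b : R) : (a <= b)%R -> Mdelta s b F <= Mdelta s a F.
Proof.
move=> ab; apply: ereal_inf_le_tmp => v [A [rho [AF rhoa vE]]].
by exists A, rho; split => // j; exact: le_trans (rhoa j) ab.
Qed.

Lemma MlimE s F :
  Mlim s F = ereal_sup [set Mdelta s delta F | delta in [set t : R | (0 < t < 1)%R]].
Proof.
rewrite /Mlim; apply/cvg_lim => //.
have -> : [set Mdelta s delta F | delta in [set t : R | (0 < t < 1)%R]] =
    (fun delta => Mdelta s delta F) @` [set` `]0%R, 1%R[].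
  by apply/seteqP; split => v /= [t t01 <-]; exists t => //=; move: t01;
    rewrite in_itv.
apply: nonincreasing_at_right_cvge; first by rewrite bnd_simp.
by move=> x y _ _ /Mdelta_anti; exact.
Qed.

End labelled_packing.

(* Main.v *)
(* Write s = dimH E. A packing of E with large total weight [sum (2 r_i)^s] would
   contain, in each of its balls, a copy of E of comparable size; these copies form
   a separated system of similarities with dimension larger than s, whose attractor
   lies in E, which is absurd. So all packings of E with bounded radii have uniformly
   bounded weight, whence dimP E <= s, and also s > 0 (apply this with exponent 0 to
   two points of E). Colouring the cubes of a grid gives M_rho(E) <= C Phi(E, rho),
   so M(E) is finite. Finally M is a metric outer measure, and M(A) <= Phi(A, R) for
   A compact in E with |A| <= R: if not, the grid bound provides, at every small
   scale, disjoint copies of A filling a definite proportion of E, and covering each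
   copy by itself makes M(E) smaller than itself. Summing this inequality over an
   arbitrary labelled cover of E yields M(E) <= M_infty(E). *)
Require Import Defs.
From mathcomp Require Import all_boot all_order all_algebra.
From mathcomp Require Import all_classical all_reals all_analysis.
From mathcomp Require Import ring lra zify.
Import Order.TTheory GRing.Theory Num.Theory.
Import numFieldNormedType.Exports.

Set Implicit Arguments.
Unset Strict Implicit.
Unset Printing Implicit Defensive.

Local Open Scope classical_set_scope.
Local Open Scope ring_scope.

(** * Euclidean distance *)

(** The maps of the attractor may overlap, so their own similarity dimension need not be the
    dimension of E. What replaces a separation condition is a packing: copies of E placed well
    inside its balls are separated automatically, and the Hausdorff dimension is at least the
    similarity dimension of this new system. A packing sum above a fixed threshold makes the sum of
    the sigma_i^s strictly larger than 1; the strictness leaves room for an exponent t > s, which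
    contradicts s = dimH E without any information on the s-dimensional Hausdorff measure of E.

    In the last argument both sides scale alike: a copy of A with ratio sigma has measure at least
    sigma^s M(A), and, used as a covering set with label sigma R, costs at most sigma^s Phi(A, R).
    If Phi(A, R) < M(A), each copy saves a fixed fraction of its measure, while its label becomes as
    small as desired. The label R itself is arbitrary, which is what reaches the unrestricted covers
    of [Minfty]. *)

Section euclidean_distance.
Context {R : realType} {d : nat}.
Implicit Types (x y z : 'rV[R]_d) (A B : set 'rV[R]_d).

Lemma eucl_dist_ge0 x y : 0 <= eucl_dist x y.
Proof. exact: sqrtr_ge0. Qed.

Lemma eucl_distxx x : eucl_dist x x = 0.
Proof.
by rewrite /eucl_dist big1 ?sqrtr0// => i _; rewrite subrr expr0n.
Qed.

Lemma eucl_distC x y : eucl_dist x y = eucl_dist y x.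
Proof.
by congr Num.sqrt; apply: eq_bigr => i _; rewrite -sqrrN opprB.
Qed.

Lemma sumr_sqr_ge0 (u : 'I_d -> R) : 0 <= \sum_i u i ^+ 2.
Proof. by apply: sumr_ge0 => i _; exact: sqr_ge0. Qed.

Lemma eucl_dist_eq0 x y : eucl_dist x y = 0 -> x = y.
Proof.
move/eqP; rewrite sqrtr_eq0 => le0; apply/rowP => i.
have /eqP : \sum_i (x 0 i - y 0 i) ^+ 2 = 0.
  by apply/eqP; rewrite eq_le le0 sumr_sqr_ge0.
rewrite psumr_eq0; last by move=> j _; exact: sqr_ge0.
by move=> /allP/(_ i (mem_index_enum _)); rewrite /= sqrf_eq0 subr_eq0 => /eqP.
Qed.

Lemma cauchy_schwarz_sum (u v : 'I_d -> R) :
  \sum_i u i * v i <= Num.sqrt (\sum_i u i ^+ 2) * Num.sqrt (\sum_i v i ^+ 2).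
Proof.
set U := \sum_i u i ^+ 2; set V := \sum_i v i ^+ 2.
have [U0|U0] := eqVneq U 0.
  rewrite U0 sqrtr0 mul0r big1// => i _.
  move/eqP: U0; rewrite psumr_eq0; last by move=> j _; exact: sqr_ge0.
  by move=> /allP/(_ i (mem_index_enum _)); rewrite /= sqrf_eq0 => /eqP->; rewrite mul0r.
have Upos : 0 < U by rewrite lt0r U0 sumr_sqr_ge0.
rewrite -sqrtrM ?(ltW Upos)//.
apply: (le_trans (ler_norm _)); rewrite -sqrtr_sqr ler_wsqrtr//.
set W := \sum_i u i * v i.
have : 0 <= \sum_i (U * v i - W * u i) ^+ 2 by exact: sumr_sqr_ge0.
have -> : \sum_i (U * v i - W * u i) ^+ 2 = U * (U * V - W ^+ 2).
  transitivity (\sum_i (U ^+ 2 * v i ^+ 2 - (U * W *+ 2) * (u i * v i) + W ^+ 2 * u i ^+ 2)).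
    by apply: eq_bigr => i _; ring.
  rewrite big_split sumrB /= -!mulr_sumr -/U -/V -/W; ring.
by rewrite pmulr_rge0// subr_ge0.
Qed.

Lemma eucl_dist_triangle y x z : eucl_dist x z <= eucl_dist x y + eucl_dist y z.
Proof.
rewrite -(ler_pXn2r (ltn0Sn 1)) ?nnegrE ?addr_ge0 ?eucl_dist_ge0//.
rewrite sqrrD !sqr_sqrtr ?sumr_sqr_ge0//.
have -> : \sum_i (x 0 i - z 0 i) ^+ 2 = \sum_i (x 0 i - y 0 i) ^+ 2
    + (\sum_i (x 0 i - y 0 i) * (y 0 i - z 0 i)) *+ 2 + \sum_i (y 0 i - z 0 i) ^+ 2.
  by rewrite -sumrMnl -!big_split; apply: eq_bigr => i _ /=; ring.
by rewrite lerD2r lerD2l lerMn2r/= cauchy_schwarz_sum.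
Qed.

Lemma coord_le_eucl_dist x y i : `|x 0 i - y 0 i| <= eucl_dist x y.
Proof.
rewrite -sqrtr_sqr ler_wsqrtr// (bigD1 i)//= lerDl.
by apply: sumr_ge0 => j _; exact: sqr_ge0.
Qed.

Lemma eucl_dist_le_coord x y (h : R) : 0 <= h ->
  (forall i, `|x 0 i - y 0 i| <= h) -> eucl_dist x y <= d%:R * h.
Proof.
move=> h0 xyh.
rewrite -[leRHS]ger0_norm ?mulr_ge0// -sqrtr_sqr ler_wsqrtr//.
apply: (@le_trans _ _ (\sum_(i < d) h ^+ 2)).
  by apply: ler_sum => i _; rewrite -real_normK ?num_real// lerXn2r ?nnegrE.
rewrite sumr_const card_ord exprMn -[leLHS]mulr_natl ler_wpM2r ?sqr_ge0//.
by rewrite -natrX ler_nat expnS expn1; case: (d) => // n; rewrite leq_pmulr.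
Qed.

(** If the centres were closer than [r + r'], the point dividing the segment in the ratio r to r'
    would lie in both balls. This passes from the disjoint balls of [packing_content] to the
    distance condition of [Phi]. *)
Lemma disjoint_closed_eball x y (r r' : R) : 0 < r -> 0 < r' ->
  closed_eball x r `&` closed_eball y r' = set0 -> r + r' <= eucl_dist x y.
Proof.
move=> r0 r'0 xy0; rewrite leNgt; apply/negP => xyr.
have rr0 : 0 < r + r' by exact: addr_gt0.
pose t := r / (r + r').
have t1 : 1 - t = r' / (r + r') by rewrite /t; field; rewrite gt_eqF.
have t0 : 0 <= t by rewrite divr_ge0// ltW.
have t1' : 0 <= 1 - t by rewrite t1 divr_ge0// ltW.
pose z : 'rV[R]_d := x + t *: (y - x).
have xz : eucl_dist x z = t * eucl_dist x y.
  rewrite /eucl_dist -[X in X * _](ger0_norm t0) -sqrtr_sqr -sqrtrM ?sqr_ge0//.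
  by congr Num.sqrt; rewrite mulr_sumr; apply: eq_bigr => i _; rewrite !mxE; ring.
have yz : eucl_dist y z = (1 - t) * eucl_dist x y.
  rewrite /eucl_dist -[X in X * _](ger0_norm t1') -sqrtr_sqr -sqrtrM ?sqr_ge0//.
  by congr Num.sqrt; rewrite mulr_sumr; apply: eq_bigr => i _; rewrite !mxE; ring.
suff : (closed_eball x r `&` closed_eball y r') z by rewrite xy0.
split; rewrite /closed_eball/= ?xz ?yz ?t1 /t mulrAC ler_pdivrMr// ler_wpM2l// ltW//.
Qed.

Lemma closure_eucl A x :
  closure A x <-> forall e : R, 0 < e -> exists2 y, A y & eucl_dist x y < e.
Proof.
split=> [clAx e e0|H B /nbhs_eballP[e e0 eB]].
  have /clAx[y [Ay xy]] : nbhs x [set y | eucl_dist x y < e].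
    by apply/nbhs_eballP; exists e.
  by exists y.
by have [y Ay xy] := H e e0; exists y; split => //; exact: eB.
Qed.

Lemma open_eucl_nbhd A (e : R) : open [set x | exists2 y, A y & eucl_dist x y < e].
Proof.
rewrite openE => x [y Ay xy]; apply/nbhs_eballP.
exists (e - eucl_dist x y); first by rewrite subr_gt0.
move=> z /= xz; exists y => //.
apply: le_lt_trans (eucl_dist_triangle x _ _) _.
by rewrite (eucl_distC z) -ltrBrDr.
Qed.

Lemma rV_hausdorff : hausdorff_space 'rV[R]_d.
Proof.
move=> x y xy; apply: eucl_dist_eq0; apply/eqP; rewrite eq_le eucl_dist_ge0 andbT.
apply/ler_addgt0Pr => e e0; rewrite add0r.
have e20 : 0 < e / 2 by rewrite divr_gt0.
have N (p : 'rV[R]_d) : nbhs p [set q | eucl_dist p q < e / 2] by apply/nbhs_eballP; exists (e / 2).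
have [z [xz yz]] := xy _ _ (N x) (N y).
apply: le_trans (eucl_dist_triangle z _ _) _.
by rewrite (eucl_distC z); apply/ltW; rewrite [ltRHS](splitr e) ltrD.
Qed.

End euclidean_distance.

(** * Countable covers *)

Section outer_measures.
Context {R : realType} {T : Type}.
Local Open Scope ereal_scope.

Definition countably_subadditive (mu : set T -> \bar R) : Prop :=
  forall (A : set T) (F : nat -> set T), A `<=` \bigcup_k F k ->
    mu A <= \sum_(0 <= k <oo) mu (F k).

Lemma nneseries_pair (a : nat -> nat -> \bar R) : (forall i j, 0 <= a i j) ->
  exists2 e : nat -> nat * nat, (forall k, exists n, e n = k) &
    \sum_(0 <= n <oo) a (e n).1 (e n).2 = \sum_(0 <= i <oo) \sum_(0 <= j <oo) a i j.
Proof.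
move=> a0; have /card_esym/ppcard_eqP[f] := card_nat2.
exists f; first by move=> k; exists (f^-1%FUN k); rewrite invK ?inE.
under [RHS]eq_eseriesr do rewrite nneseries_esumT//.
rewrite !nneseries_esumT => [|i|//]; last exact: esum_ge0.
rewrite esum_esum// (reindex_esum setT _ f)//.
by have := @bij _ _ _ _ f; congr set_bij; apply/seteqP; split.
Qed.

Lemma nneseries_fin (n : nat) (f : nat -> \bar R) :
  (forall k, 0 <= f k) -> (forall k, (n <= k)%N -> f k = 0) ->
  \sum_(0 <= k <oo) f k = \sum_(k < n) f k.
Proof.
move=> f0 fn0; rewrite (nneseries_split 0%N n)// add0n [X in _ + X]eseries0 => [|k nk _].
  by rewrite adde0 big_mkord.
exact: fn0.
Qed.

(** Pads a finite family to a sequence with a weightless label [l0], so that finite covers can be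
    used where the definitions ask for sequences. *)
Lemma nneseries_finType (J : finType) (L : Type) (g : L -> \bar R) (l0 : L) (l : J -> L) :
  (forall l, 0 <= g l) -> g l0 = 0 ->
  exists e : nat -> L, [/\ forall n, e n = l0 \/ exists j, e n = l j,
    forall j, exists n, e n = l j &
    \sum_(0 <= n <oo) g (e n) = \sum_(j : J) g (l j)].
Proof.
move=> g_ge0 g0.
pose e n := if insub n is Some i then l (enum_val (i : 'I_#|J|)) else l0.
have eE (i : 'I_#|J|) : e i = l (enum_val i) by rewrite /e valK.
exists e; split=> [n|j|].
- by rewrite /e; case: insubP => [i _ _|_]; [right; eexists|left].
- by exists (enum_rank j); rewrite eE enum_rankK.
- rewrite (@nneseries_fin #|J|)// => [|k nk].
    under eq_bigr do rewrite eE.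
    by rewrite [RHS](reindex (@enum_val _ J))//; exact/onW_bij/enum_val_bij.
  by rewrite /e insubF// ltnNge nk.
Qed.

Lemma finitely_subadditive (mu : set T -> \bar R) (J : finType) (A : set T) (F : J -> set T) :
  countably_subadditive mu -> (forall B, 0 <= mu B) -> mu set0 = 0 ->
  (forall x, A x -> exists j, F j x) -> mu A <= \sum_(j : J) mu (F j).
Proof.
move=> mu_sub mu_ge0 mu0 AF.
have [e [_ e_surj <-]] := nneseries_finType F mu_ge0 mu0.
apply: mu_sub => x /AF[j Fjx]; have [n en] := e_surj j.
by exists n => //; rewrite en.
Qed.

Lemma subadditiveU (mu : set T -> \bar R) (A B C : set T) :
  countably_subadditive mu -> (forall B, 0 <= mu B) -> mu set0 = 0 ->
  A `<=` B `|` C -> mu A <= mu B + mu C.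
Proof.
move=> mu_sub mu_ge0 mu0 ABC.
have := @finitely_subadditive mu bool A (fun b => if b then B else C).
rewrite big_bool; apply=> // x /ABC[]; [by exists true|by exists false].
Qed.

(** * Outer measures from weighted covers (Carathéodory's Method I) *)

Section method_I.
Context {L : Type} (Q : L -> Prop) (X : L -> set T) (w : L -> \bar R).

(** Common form of [hausdorff_premeasure] and [Mdelta]. Labels are kept apart from their sets
    because the weight in [Mdelta] depends on the radius as well. *)
Definition cover_outer (F : set T) : \bar R :=
  ereal_inf [set v | exists l : nat -> L,
    [/\ forall j, Q (l j), F `<=` \bigcup_j X (l j) & v = \sum_(0 <= j <oo) w (l j)]].

Hypothesis w_ge0 : forall l, Q l -> 0 <= w l.

Lemma cover_outer_ge0 F : 0 <= cover_outer F.
Proof.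
apply: le_ereal_inf_tmp => v [l [Ql _ ->]]; apply: nneseries_ge0 => j _ _.
exact: w_ge0.
Qed.

Lemma cover_outer_le F (l : nat -> L) : (forall j, Q (l j)) -> F `<=` \bigcup_j X (l j) ->
  cover_outer F <= \sum_(0 <= j <oo) w (l j).
Proof. by move=> Ql Fl; apply: ereal_inf_lbound; exists l. Qed.

Lemma cover_outer_subadditive : countably_subadditive cover_outer.
Proof.
move=> A F AF.
have [[i Fi]|] := pselect (exists i, cover_outer (F i) = +oo).
  rewrite (eseries_pinfty _ _ Fi) ?leey// => n _.
  by rewrite -ltNye (lt_le_trans _ (cover_outer_ge0 _)).
rewrite -forallNE => Foo.
apply/lee_addgt0Pr => e e0.
apply: le_trans (epsilon_trick _ _ (ltW e0)); last by move=> n; exact: cover_outer_ge0.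
have [l lP] : {l : nat -> nat -> L & forall n, [/\ forall j, Q (l n j),
    F n `<=` \bigcup_j X (l n j) &
    \sum_(0 <= j <oo) w (l n j) <= cover_outer (F n) + (e / (2 ^ n.+1)%:R)%:E]}.
  apply: (@choice _ _ (fun n ln => [/\ forall j, Q (ln j), F n `<=` \bigcup_j X (ln j) &
    \sum_(0 <= j <oo) w (ln j) <= cover_outer (F n) + (e / (2 ^ n.+1)%:R)%:E])) => n.
  have fin : cover_outer (F n) \is a fin_num.
    by rewrite ge0_fin_numE ?cover_outer_ge0// ltey; apply/eqP; exact: Foo.
  have en : (0 < e / (2 ^ n.+1)%:R)%R by rewrite divr_gt0// ltr0n expn_gt0.
  have [_ [l [Ql Fl ->]] /ltW ln] := lb_ereal_inf_adherent en fin.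
  by exists l.
have wl0 i j : 0 <= w (l i j) by apply: w_ge0; have [] := lP i.
have [f fsurj fE] := nneseries_pair wl0.
apply: (@le_trans _ _ (\sum_(0 <= i <oo) \sum_(0 <= j <oo) w (l i j))); last first.
  by apply: lee_nneseries => [i _ _|i _]; [exact: nneseries_ge0|have [] := lP i].
rewrite -fE; apply: (cover_outer_le (l := fun n => l (f n).1 (f n).2)) => [j|x /AF[i _ Fix]].
  by have [] := lP (f j).1.
have [_ /(_ _ Fix)[j _ Xx] _] := lP i.
by have [n fn] := fsurj (i, j); exists n => //=; rewrite fn.
Qed.

Lemma cover_outer_fin_le (l0 : L) (J : finType) (l : J -> L) F :
  Q l0 -> w l0 = 0 -> (forall j, Q (l j)) -> (forall x, F x -> exists j, X (l j) x) ->
  cover_outer F <= \sum_(j : J) w (l j).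
Proof.
(* [nneseries_finType] wants a weight that is nonnegative everywhere; [w] is known to be so on
   admissible labels only. *)
move=> Q0 w0 Ql Fl; pose w' k := if pselect (Q k) then w k else 0.
have w'_ge0 k : 0 <= w' k by rewrite /w'; case: pselect => [Qk|//]; exact: w_ge0.
have w'E k : Q k -> w' k = w k by rewrite /w'; case: pselect.
have w'0 : w' l0 = 0 by rewrite w'E.
have [e [eE e_surj]] := nneseries_finType l w'_ge0 w'0.
have Qe n : Q (e n) by have [->|[j ->]] := eE n.
under eq_eseriesr do rewrite w'E//.
under [X in _ = X -> _]eq_bigr do rewrite w'E//.
move=> <-; apply: cover_outer_le => // x /Fl[j Xj].
by have [n en] := e_surj j; exists n => //; rewrite en.
Qed.

End method_I.

End outer_measures.

(** * Packings and premeasures *)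

Section premeasures.
Context {R : realType} {d : nat}.
Implicit Types (x y : 'rV[R]_d) (s delta rho : R) (A B F : set 'rV[R]_d).
Local Open Scope ereal_scope.

Lemma diam_ge0 A : 0 <= diam A.
Proof. by rewrite /diam le_max lexx. Qed.

Lemma diam_le A (r : R) : (0 <= r)%R ->
  (forall x y, A x -> A y -> (eucl_dist x y <= r)%R) -> diam A <= r%:E.
Proof.
move=> r0 Ar; rewrite ge_max lee_fin r0/=; apply: ge_ereal_sup => _ [x Ax [y Ay <-]].
by rewrite lee_fin Ar.
Qed.

Lemma eucl_dist_le_diam A (r : R) x y : diam A <= r%:E -> A x -> A y -> (eucl_dist x y <= r)%R.
Proof.
rewrite ge_max => /andP[_ supr] Ax Ay; rewrite -lee_fin; apply: le_trans supr.
by apply: ereal_sup_ubound; exists x => //; exists y.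
Qed.

Lemma diam0 : diam (set0 : set 'rV[R]_d) = 0.
Proof.
by apply/eqP; rewrite eq_le diam_ge0 andbT; apply: diam_le.
Qed.

Lemma diam_mono A B (r : R) : A `<=` B -> diam B <= r%:E -> diam A <= r%:E.
Proof.
move=> AB Br; apply: diam_le => [|x y /AB Bx /AB By]; last exact: eucl_dist_le_diam Br Bx By.
by rewrite -lee_fin (le_trans (diam_ge0 B)).
Qed.

Lemma closure_close A x (e : R) : closure A x -> (0 < e)%R ->
  exists2 y, A y & (eucl_dist x y < e)%R.
Proof. by move=> /closure_eucl; exact. Qed.

Lemma closure_dist_ge A B (g : R) x y :
  (forall x y, A x -> B y -> (g <= eucl_dist x y)%R) ->
  closure A x -> closure B y -> (g <= eucl_dist x y)%R.
Proof.
move=> ABg clAx clBy; apply/ler_addgt0Pr => e e0.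
have e20 : (0 < e / 2)%R by rewrite divr_gt0.
have [x' Ax' xx'] := closure_close clAx e20.
have [y' By' yy'] := closure_close clBy e20.
apply: le_trans (ABg _ _ Ax' By') _.
apply: le_trans (eucl_dist_triangle x _ _) _.
apply: le_trans (lerD (lexx _) (eucl_dist_triangle y _ _)) _.
rewrite (eucl_distC x'); rewrite [leRHS](_ : _ = e / 2 + (eucl_dist x y + e / 2))%R.
  by rewrite lerD ?lerD// ltW.
by rewrite {1}(splitr e); ring.
Qed.

Lemma diam_closure A (r : R) : diam A <= r%:E -> diam (closure A) <= r%:E.
Proof.
move=> Ar; apply: diam_le => [|x y clAx clAy].
  by rewrite -lee_fin (le_trans (diam_ge0 A)).
apply/ler_addgt0Pr => e e0.
have e20 : (0 < e / 2)%R by rewrite divr_gt0.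
have [x' Ax' xx'] := closure_close clAx e20.
have [y' Ay' yy'] := closure_close clAy e20.
apply: le_trans (eucl_dist_triangle x' _ _) _.
apply: le_trans (lerD (lexx _) (eucl_dist_triangle y' _ _)) _.
rewrite (eucl_distC y'); rewrite [leRHS](_ : _ = e / 2 + (r + e / 2))%R.
  apply: lerD (ltW xx') (lerD _ (ltW yy')).
  exact: eucl_dist_le_diam Ar Ax' Ay'.
by rewrite {1}(splitr e); ring.
Qed.

Lemma hausdorff_premeasureE s delta :
  hausdorff_premeasure s delta = cover_outer (fun U : set 'rV[R]_d => diam U <= delta%:E)
    id (fun U => diam U `^ s).
Proof.
apply/funext => F; congr ereal_inf; apply/seteqP; split=> v [U [H1 H2 H3]];
  by exists U.
Qed.

Lemma Mdelta_coverE s delta :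
  Mdelta s delta = cover_outer
    (fun l : set 'rV[R]_d * R => (0 < l.2 <= delta)%R /\ diam l.1 <= l.2%:E)
    fst (fun l => Phi s l.1 l.2).
Proof.
apply/funext => F; congr ereal_inf; apply/seteqP; split=> v.
  move=> [A [rho [[FA Arho] rhod ->]]]; exists (fun j => (A j, rho j)).
  by split=> // j; have [-> Aj] := Arho j; rewrite rhod.
move=> [l [Ql Fl ->]]; exists (fst \o l), (snd \o l); split=> //.
  by split=> // j; have [/andP[]] := Ql j.
by move=> j; have [/andP[]] := Ql j.
Qed.

(** Lists make the union of two packings a concatenation. The empty list, excluded in [Phi], has sum
    0, which is harmless because [Phi] is nonnegative for a positive radius. *)
Definition packing A (rho : R) (p : seq ('rV[R]_d * R)) : Prop :=
  (forall q, q \in p -> A q.1 /\ (0 < q.2 <= rho)%R) /\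
  pairwise (fun q q' => q.2 + q'.2 <= eucl_dist q.1 q'.1)%R p.

Definition packing_sum s (p : seq ('rV[R]_d * R)) : R := (\sum_(q <- p) (2 * q.2) `^ s)%R.

Lemma packing_nil A rho : packing A rho [::].
Proof. by split. Qed.

Lemma packing_cat A B rho p q : packing A rho p -> packing B rho q ->
  (forall x y, A x -> B y -> (rho + rho <= eucl_dist x y)%R) ->
  packing (A `|` B) rho (p ++ q).
Proof.
move=> [pA psep] [qB qsep] AB; split.
  move=> z; rewrite mem_cat => /orP[/pA|/qB] [zA zr]; split => //; [by left|by right].
rewrite pairwise_cat psep qsep !andbT; apply/allrelP => z z'.
move=> /pA[Az /andP[_ zr]] /qB[Bz' /andP[_ zr']].
by apply: le_trans (AB _ _ Az Bz'); exact: lerD.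
Qed.

Lemma packing_mono A B rho rho' p : A `<=` B -> (rho <= rho')%R ->
  packing A rho p -> packing B rho' p.
Proof.
move=> AB rr [pA psep]; split=> // q /pA[Aq /andP[-> qr]].
by split; [exact: AB|exact: le_trans rr].
Qed.

Lemma packing_nth A rho p (z : 'rV[R]_d * R) i j : packing A rho p ->
  (i < size p)%N -> (j < size p)%N -> i != j ->
  ((nth z p i).2 + (nth z p j).2 <= eucl_dist (nth z p i).1 (nth z p j).1)%R.
Proof.
move=> [_ /(pairwiseP z) psep] ip jp; rewrite neq_ltn => /orP[ij|ij].
  by apply: psep.
by rewrite addrC eucl_distC; apply: psep.
Qed.

Lemma packing_of_fun A rho N (x : 'I_N -> 'rV[R]_d) (r : 'I_N -> R) :
  (forall i, A (x i)) -> (forall i, 0 < r i <= rho)%R ->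
  (forall i j, i != j -> (r i + r j <= eucl_dist (x i) (x j))%R) ->
  exists2 p, packing A rho p & forall s, packing_sum s p = (\sum_(i < N) (2 * r i) `^ s)%R.
Proof.
move=> Ax rrho sep; exists [seq (x i, r i) | i <- enum 'I_N].
  split=> [q /mapP[i _ ->]|] /=; first by split; [exact: Ax|exact: rrho].
  rewrite pairwise_map; apply: (sub_pairwise (r := [rel i j | i != j])) => [i j /= /sep//|].
  by rewrite -uniq_pairwise enum_uniq.
by move=> s; rewrite /packing_sum big_map big_enum.
Qed.

Lemma Phi_set0 s rho : Phi s (set0 : set 'rV[R]_d) rho = 0.
Proof. by rewrite /Phi eqxx. Qed.

Lemma Phi_le s A rho (v : \bar R) : 0 <= v ->
  (forall p, packing (closure A) rho p -> (packing_sum s p)%:E <= v) -> Phi s A rho <= v.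
Proof.
move=> v0 pv; rewrite /Phi; case: ifPn => // _.
apply: ge_ereal_sup => _ [N [x [r [_ clAx rrho sep ->]]]].
by have [p /pv pAr <-] := packing_of_fun clAx rrho sep.
Qed.

Lemma Phi_ge1 s A rho x : (0 < rho)%R -> A x -> ((2 * rho) `^ s)%R%:E <= Phi s A rho.
Proof.
move=> rho0 Ax; rewrite /Phi; case: ifPn => [/eqP A0|_]; first by rewrite A0 in Ax.
apply: ereal_sup_ubound; exists 1%N, (fun=> x), (fun=> rho); split => //.
- by move=> _; exact: subset_closure.
- by move=> _; rewrite rho0 lexx.
- by move=> i j; rewrite !ord1.
- by rewrite big_ord1.
Qed.

Lemma Phi_ge0 s A rho : (0 < rho)%R -> 0 <= Phi s A rho.
Proof.
move=> rho0; have [->|/set0P[x Ax]] := eqVneq A set0; first by rewrite Phi_set0.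
by apply: le_trans (Phi_ge1 s rho0 Ax); rewrite lee_fin powR_ge0.
Qed.

Lemma packing_sum_le_Phi s A rho p : (0 < rho)%R -> packing (closure A) rho p ->
  (packing_sum s p)%:E <= Phi s A rho.
Proof.
move=> rho0 pA; case: p pA => [|z p] pA.
  by rewrite /packing_sum big_nil Phi_ge0.
have An0 : A != set0.
  apply/set0P; have [/(_ z)[|clAz _ _]] := pA; first by rewrite inE eqxx.
  by have [y Ay _] := closure_close clAz ltr01; exists y.
rewrite /Phi (negbTE An0); apply: ereal_sup_ubound.
pose q := z :: p; exists (size q), (fun i => (nth z q i).1), (fun i => (nth z q i).2).
have [pAr _] := pA; split=> //.
- by move=> i; have [] := pAr (nth z q i) (mem_nth _ (ltn_ord i)).
- by move=> i; have [] := pAr (nth z q i) (mem_nth _ (ltn_ord i)).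
- by move=> i j ij; apply: (packing_nth z pA).
- by rewrite /packing_sum (big_nth z) big_mkord.
Qed.

(** The centres counted by [Phi] range over the closure; in this form the lemma lets the sets of a
    cover be replaced by closed ones at no cost. *)
Lemma Phi_mono s A B rho : (0 < rho)%R -> A `<=` closure B -> Phi s A rho <= Phi s B rho.
Proof.
move=> rho0 AB; apply: Phi_le => [|p pA]; first exact: Phi_ge0.
apply: packing_sum_le_Phi => //; apply: packing_mono pA => //.
by have := closure_subset AB; rewrite -((closure_id (closure B)).1 (@closed_closure _ B)).
Qed.

Lemma Phi_superadditive s A B C rho : (0 < rho)%R -> A `<=` C -> B `<=` C ->
  (forall x y, A x -> B y -> (rho + rho <= eucl_dist x y)%R) ->
  Phi s A rho + Phi s B rho <= Phi s C rho.
Proof.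
move=> rho0 AC BC sep.
have H p q : packing (closure A) rho p -> packing (closure B) rho q ->
    (packing_sum s p)%:E + (packing_sum s q)%:E <= Phi s C rho.
  move=> pA qB; rewrite -EFinD /packing_sum -big_cat.
  apply: packing_sum_le_Phi => //.
  apply: (packing_mono _ (lexx _) (packing_cat pA qB _)) => [x [clAx|clBx]|x y clAx clBy].
  - exact: closure_subset clAx.
  - exact: closure_subset clBx.
  - exact: closure_dist_ge clAx clBy.
(* The two suprema are taken one after the other, each time with the other term moved across the
   inequality; this needs finite values. *)
have [->|C_fin] := eqVneq (Phi s C rho) +oo; first by rewrite leey.
have Cf : Phi s C rho \is a fin_num by rewrite ge0_fin_numE ?Phi_ge0// lt_neqAle C_fin leey.
have step p : packing (closure A) rho p ->
    Phi s B rho <= Phi s C rho - (packing_sum s p)%:E.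
  move=> pA; apply: Phi_le => [|q qB]; rewrite leeBrDr// ?add0e; last by rewrite addeC H.
  by apply: packing_sum_le_Phi => //; apply: packing_mono pA => //; exact: closure_subset.
have BfC : Phi s B rho <= Phi s C rho by apply: Phi_mono => // x /BC /subset_closure.
have Bf : Phi s B rho \is a fin_num.
  by rewrite ge0_fin_numE ?Phi_ge0//; apply: le_lt_trans BfC _; rewrite ltey_eq Cf.
rewrite -leeBrDr//; apply: Phi_le => [|p /step]; first by rewrite leeBrDr// add0e.
by rewrite leeBrDr// addeC -leeBrDr.
Qed.

End premeasures.

(** * Separated systems of similarities *)

Section finite_families.
Context {R : realType} {J : finType}.
Implicit Types (f rho : J -> R).

Lemma finite_positive_lbound f : (forall i, 0 < f i) ->
  exists2 m, 0 < m < 1 & forall i, m <= f i.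
Proof.
move=> f0; exists (\big[Num.min/2^-1]_i f i); last by move=> i; exact: bigmin_le.
apply/andP; split; first by rewrite lt_bigmin// invr_gt0.
by apply: le_lt_trans (bigmin_le_id _ _ _ _) _; rewrite invf_lt1// ltr1n.
Qed.

Lemma finite_lt1_ubound f : (forall i, f i < 1) ->
  exists2 q, 0 < q < 1 & forall i, f i <= q.
Proof.
move=> f1; exists (\big[Num.max/2^-1]_i f i); last by move=> i; exact: le_bigmax.
apply/andP; split; last by rewrite bigmax_lt// invf_lt1// ltr1n.
by apply: lt_le_trans (bigmax_ge_id _ _ _ _); rewrite invr_gt0.
Qed.

Lemma powR_sum_gt1 rho (u : R) : (forall i, 0 < rho i) -> 1 < \sum_i rho i `^ u ->
  exists2 t, u < t & 1 <= \sum_i rho i `^ t.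
Proof.
move=> rho0; set S := (\sum_i _) => S1.
have S0 : 0 < S by exact: lt_trans S1.
have [m /andP[m0 m1] mrho] := finite_positive_lbound rho0.
have lnm : ln m < 0 by rewrite ln_lt0// m0.
(* The solution of m^h = 1/S: raising the exponent by [h] multiplies each term by [rho i] to the
   power h, which is at least 1/S. *)
pose h := - (ln S / ln m).
have h0 : 0 < h by rewrite /h oppr_gt0 pmulr_rlt0 ?ln_gt0// invr_lt0.
exists (u + h); first by rewrite ltrDl.
have -> : 1 = S * m `^ h.
  rewrite /powR gt_eqF// /h mulNr -mulrA mulVf ?lt_eqF// mulr1 expRN lnK ?posrE//.
  by rewrite divff// gt_eqF.
rewrite mulr_suml; apply: ler_sum => i _.
rewrite powRD; last by rewrite (gt_eqF (rho0 i)) implybT.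
by rewrite ler_wpM2l ?powR_ge0// ge0_ler_powR ?nnegrE// ltW.
Qed.

End finite_families.

Section separated_iterated_function_system.
Context {R : realType} {d : nat} {J : finType}.
Variables (T : J -> 'rV[R]_d -> 'rV[R]_d) (rho : J -> R) (E : set 'rV[R]_d) (g t : R).
Hypothesis rho01 : forall i, 0 < rho i < 1.
Hypothesis T_sim : forall i x y, eucl_dist (T i x) (T i y) = rho i * eucl_dist x y.
Hypothesis TE : forall i x, E x -> E (T i x).
Hypothesis g0 : 0 < g.
Hypothesis T_sep : forall i j x y, i != j -> E x -> E y -> g <= eucl_dist (T i x) (T j y).
Hypothesis t0 : 0 < t.
Hypothesis sum_ge1 : 1 <= \sum_i rho i `^ t.
Hypothesis E_compact : compact E.
Variable (x0 : 'rV[R]_d).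
Hypothesis Ex0 : E x0.

Let S := \sum_i rho i `^ t.
Let p i := rho i `^ t / S.

(* The [k]-th discrete approximation of the self-similar measure with weights [p]. *)
Fixpoint mass (k : nat) (U : set 'rV[R]_d) : R :=
  if k is k'.+1 then \sum_i p i * mass k' (T i @^-1` U) else (`[< U x0 >])%:R.

Let S0 : 0 < S. Proof. exact: lt_le_trans sum_ge1. Qed.

Let p_ge0 i : 0 <= p i. Proof. by rewrite divr_ge0 ?powR_ge0// ltW. Qed.

Let p_le i : p i <= rho i `^ t.
Proof. by rewrite ler_pdivrMr// ler_peMr// powR_ge0. Qed.

Let sum_p : \sum_i p i = 1.
Proof. by rewrite -mulr_suml divff// gt_eqF. Qed.

Lemma mass_le1 k U : mass k U <= 1.
Proof.
elim: k U => [|k IH] U /=; first by case: `[< _ >]; rewrite ?ler01.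
by rewrite -sum_p; apply: ler_sum => i _; rewrite ler_piMr.
Qed.

Lemma mass_full k U : E `<=` U -> mass k U = 1.
Proof.
elim: k U => [|k IH] U EU /=; first by rewrite asboolT//; exact: EU.
rewrite -[RHS]sum_p; apply: eq_bigr => i _; rewrite IH ?mulr1// => x Ex.
exact/EU/TE.
Qed.

Lemma mass_disjoint k U : (forall x, E x -> ~ U x) -> mass k U = 0.
Proof.
elim: k U => [|k IH] U EU /=; first by rewrite asboolF//; exact: EU.
by rewrite big1// => i _; rewrite IH ?mulr0// => x Ex; exact/EU/TE.
Qed.

Lemma mass_cover k n U (V : nat -> set 'rV[R]_d) :
  (forall x, U x -> exists2 j, (j < n)%N & V j x) -> mass k U <= \sum_(j < n) mass k (V j).
Proof.
elim: k U V => [|k IH] U V UV /=.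
  have [/UV[j jn Vj]|_] := asboolP (U x0); last by apply: sumr_ge0 => j _; exact: ler0n.
  rewrite (bigD1 (Ordinal jn))//= asboolT// lerDl.
  by apply: sumr_ge0 => i _; exact: ler0n.
rewrite exchange_big/=; apply: ler_sum => i _; rewrite -mulr_sumr ler_wpM2l//.
by apply: (IH _ (fun j => T i @^-1` V j)) => x Ux; exact: (UV (T i x)).
Qed.

(** Mass distribution principle at finite depth. If [U] meets two first-level copies of E, then u >=
    g and the bound is at least 1. If it meets only one, pulling back through that copy divides [u]
    by [rho i] and multiplies the mass by p_i <= rho_i^t. The term q^k is what remains when the
    depth is exhausted. *)
Lemma mass_le_diam (q : R) k U (u : R) : (forall i, rho i `^ t <= q) -> 0 <= u ->
  (forall x y, U x -> U y -> eucl_dist x y <= u) -> mass k U <= (u / g) `^ t + q ^+ k.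
Proof.
move=> rhoq; elim: k U u => [|k IH] U u u0 Uu.
  by rewrite expr0 (le_trans (mass_le1 _ _))// lerDr powR_ge0.
have q0 : 0 <= q.
  have [i _|J0] := pickP J; first exact: le_trans (powR_ge0 _ _) (rhoq i).
  by move: sum_p => /eqP; rewrite big_pred0// eq_sym oner_eq0.
have rhs0 : 0 <= (u / g) `^ t + q ^+ k.+1 by rewrite addr_ge0 ?powR_ge0 ?exprn_ge0.
have [[i [x Ex Ux]]|none] := pselect (exists i, exists2 x, E x & U (T i x)); last first.
  rewrite /= big1// => i _; rewrite mass_disjoint ?mulr0// => x Ex Ux.
  by apply: none; exists i, x.
have [[j [y [ij Ey Uy]]]|only] := pselect (exists j, exists y, [/\ i != j, E y & U (T j y)]).
  rewrite (le_trans (mass_le1 _ _))//.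
  apply: (@le_trans _ _ ((u / g) `^ t)); last by rewrite lerDl exprn_ge0.
  have gu : g <= u by exact: le_trans (T_sep ij Ex Ey) (Uu _ _ Ux Uy).
  rewrite -(powRr0 (u / g)); apply: ler_powR; last exact: ltW.
  by rewrite ler_pdivlMr// mul1r.
rewrite /= (bigD1 i)//= [X in _ + X]big1 => [|j ji]; last first.
  rewrite mass_disjoint ?mulr0// => y Ey Uy; apply: only; exists j, y.
  by rewrite eq_sym.
have /andP[rho0 _] := rho01 i.
rewrite addr0; apply: (@le_trans _ _ (p i * ((u / rho i / g) `^ t + q ^+ k))).
  rewrite ler_wpM2l//; apply: IH => [|y z Uy Uz]; first by rewrite divr_ge0// ltW.
  by rewrite ler_pdivlMr// mulrC -T_sim; exact: Uu.
rewrite mulrDr exprS lerD//.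
  apply: (@le_trans _ _ (rho i `^ t * (u / rho i / g) `^ t)).
    by rewrite ler_wpM2r ?powR_ge0.
  rewrite -powRM ?(ltW rho0)//; last by rewrite !divr_ge0// ltW.
  by rewrite (_ : rho i * _ = u / g)//; field; rewrite !gt_eqF.
by rewrite ler_wpM2r ?exprn_ge0// (le_trans (p_le i)).
Qed.

Local Open Scope ereal_scope.

Lemma hausdorff_premeasure_ge delta :
  (g `^ t / 2)%:E <= hausdorff_premeasure t delta E.
Proof.
apply: le_ereal_inf_tmp => _ [U [EU Ud ->]].
pose u j := fine (diam (U j)).
have ufin j : diam (U j) \is a fin_num.
  by rewrite ge0_fin_numE ?diam_ge0//; exact: le_lt_trans (Ud j) (ltry _).
have uE j : diam (U j) = (u j)%:E by rewrite fineK.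
have u0 j : (0 <= u j)%R by rewrite -lee_fin -uE diam_ge0.
have Uu j x y : U j x -> U j y -> (eucl_dist x y <= u j)%R.
  by apply: eucl_dist_le_diam; rewrite uE.
have gt0 : (0 < g `^ t)%R by rewrite powR_gt0.
(* One quarter of g^t pays for enlarging the [U j] to open sets and one quarter for the depth errors
   n q^k; one half is left. *)
pose c : R := (g `^ t / 4)%R; pose eta j : R := (c / (2 ^ j.+1)%:R)%R.
have c0 : (0 < c)%R by rewrite divr_gt0.
have eta0 j : (0 < eta j)%R by rewrite divr_gt0// ltr0n expn_gt0.
(* The enlarged diameter is defined through its t-th power, so that the cost is exactly [eta j] and
   [v j > u j] even when [u j] is 0. *)
pose v j := ((u j `^ t + eta j) `^ t^-1)%R.
have vt j : (v j `^ t = u j `^ t + eta j)%R.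
  by rewrite -powRrM mulVf ?gt_eqF// powRr1// addr_ge0 ?powR_ge0// ltW.
have uv j : (u j < v j)%R.
  have -> : u j = ((u j `^ t) `^ t^-1)%R by rewrite -powRrM divff ?gt_eqF// powRr1.
  by rewrite gt0_ltr_powR ?invr_gt0 ?nnegrE ?addr_ge0 ?powR_ge0 ?(ltW (eta0 j))// ltrDl.
pose V j := [set x | exists2 y, U j y & (eucl_dist x y < (v j - u j) / 2)%R].
have Vv j x y : V j x -> V j y -> (eucl_dist x y <= v j)%R.
  move=> [x' Ux' xx'] [y' Uy' yy'].
  apply: le_trans (eucl_dist_triangle x' _ _) _.
  apply: le_trans (lerD (lexx _) (eucl_dist_triangle y' _ _)) _.
  rewrite (eucl_distC y'); have := Uu _ _ _ Ux' Uy'.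
  by move: xx' yy'; lra.
have Vo j : open (V j) by exact: open_eucl_nbhd.
have EV : E `<=` \bigcup_j V j.
  move=> x /EU[j _ Ux]; exists j => //; exists x => //.
  by rewrite eucl_distxx divr_gt0// subr_gt0.
move: E_compact; rewrite compact_cover => /(_ _ setT V (fun j _ => Vo j) EV)[D _ EVD].
pose n := (\max_(j <- finmap.enum_fset D) j).+1.
have EVn x : E x -> exists2 j, (j < n)%N & V j x.
  by move=> /EVD[j /= jD Vx]; exists j => //; rewrite ltnS leq_bigmax_seq.
have [q /andP[q0 q1] rhoq] : exists2 q : R, (0 < q < 1)%R & forall i, (rho i `^ t <= q)%R.
  apply: finite_lt1_ubound => i; have /andP[rho0 rho1] := rho01 i.
  have <- : (1 `^ t = 1 :> R)%R by rewrite powR1.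
  by rewrite gt0_ltr_powR ?nnegrE// ltW.
(* The depth is chosen after the number [n] of sets of a finite subcover; a measure of finite depth
   then suffices, and no limit measure has to be built. *)
have [k qk] : exists k, (n%:R * q ^+ k <= 4^-1 :> R)%R.
  have e0 : (0 < 4^-1 / n%:R :> R)%R by rewrite divr_gt0 ?ltr0n// invr_gt0.
  have : (fun k => q ^+ k)%R @ \oo --> (0 : R)%R.
    by apply: cvg_expr; rewrite ger0_norm// ltW.
  move=> /cvgrPdist_le/(_ _ e0)[k _ /(_ k (leqnn k))]; rewrite sub0r normrN.
  rewrite ger0_norm ?exprn_ge0 ?(ltW q0)// ler_pdivlMr ?ltr0n// mulrC => ?.
  by exists k.
have mass1 : (1 <= (\sum_(j < n) (v j `^ t)) / g `^ t + 4^-1)%R.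
  rewrite -[leLHS](mass_full k (@subset_refl _ E)).
  apply: le_trans (mass_cover k EVn) _.
  apply: (@le_trans _ _ (\sum_(j < n) ((v j / g) `^ t + q ^+ k))%R).
    apply: ler_sum => j _; apply: mass_le_diam => //; last exact: Vv.
    exact: le_trans (ltW (uv j)).
  rewrite big_split/= sumr_const card_ord -[(_ *+ n)%R]mulr_natl lerD//.
  rewrite mulr_suml; apply: ler_sum => j _.
  have v0 : (0 <= v j)%R by exact: le_trans (ltW (uv j)).
  rewrite powRM ?invr_ge0// ?(ltW g0)// -powR_inv1 ?(ltW g0)//.
  by rewrite powRAC powR_inv1// powR_ge0.
have eta_sum : (\sum_(j < n) eta j <= c)%R.
  rewrite -lee_fin -sumEFin -(big_mkord xpredT (fun j => (eta j)%:E)).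
  apply: le_trans (epsilon_trick0 xpredT (ltW c0)).
  by apply: nneseries_lim_ge => j _ _; rewrite lee_fin ltW.
apply: (@le_trans _ _ (\sum_(0 <= j < n) diam (U j) `^ t)); last first.
  by apply: nneseries_lim_ge => j _ _; exact: poweR_ge0.
rewrite big_mkord; under eq_bigr do rewrite uE poweR_EFin.
rewrite sumEFin lee_fin.
move: mass1; under eq_bigr do rewrite vt.
rewrite big_split/= -lerBlDr ler_pdivlMr//.
by move: eta_sum; rewrite /c; lra.
Qed.

End separated_iterated_function_system.

(** * Copies of an attractor inside itself *)

Section copies.
Context {R : realType} {d : nat}.
Implicit Types (E : set 'rV[R]_d) (T : 'rV[R]_d -> 'rV[R]_d) (rho : R).

Definition self_copy E T rho : Prop :=
  [/\ 0 < rho < 1, forall x y, eucl_dist (T x) (T y) = rho * eucl_dist x y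
    & forall x, E x -> E (T x)].

(** For 0 < s < t the sum of the rho_i^s is at least 1 too, so the mass distribution at exponent s
    itself shows that the s-dimensional measure of E is positive. *)
Lemma dimH_ge (J : finType) E (T : J -> 'rV[R]_d -> 'rV[R]_d) (rho : J -> R) (g t : R) :
  E !=set0 -> compact E -> (forall i, self_copy E (T i) (rho i)) -> 0 < g ->
  (forall i j x y, i != j -> E x -> E y -> g <= eucl_dist (T i x) (T j y)) ->
  1 <= \sum_i rho i `^ t -> (t%:E <= dimH E)%E.
Proof.
move=> [x0 Ex0] cE TE g0 sep sum1.
apply: le_ereal_inf_tmp => _ [s [s0 sE] <-]; rewrite lee_fin leNgt; apply/negP => st.
have rho01 i : 0 < rho i < 1 by have [] := TE i.
have Tsim i x y : eucl_dist (T i x) (T i y) = rho i * eucl_dist x y by have [] := TE i.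
have TEE i x : E x -> E (T i x) by have [_ _] := TE i; exact.
have sum_s : 1 <= \sum_i rho i `^ s.
  apply: le_trans sum1 _; apply: ler_sum => i _; have /andP[r0 r1] := rho01 i.
  by apply: ger_powR (ltW st); rewrite r0 ltW.
suff : (0 < hausdorff_measure s E)%E by rewrite sE ltxx.
apply: (@lt_le_trans _ _ (g `^ s / 2)%:E); first by rewrite lte_fin divr_gt0// powR_gt0.
apply: le_trans (hausdorff_premeasure_ge rho01 Tsim TEE g0 sep s0 sum_s cE Ex0 1) _.
by apply: ereal_sup_ubound; exists 1 => //=.
Qed.

Lemma compact_eucl_bounded E : compact E ->
  exists2 D : R, 0 < D & forall x y, E x -> E y -> eucl_dist x y <= D.
Proof.
move=> cE.
pose V (n : nat) := [set x : 'rV[R]_d | exists2 y, [set 0] y & eucl_dist x y < n%:R].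
have Vo n : open (V n) by exact: open_eucl_nbhd.
have EV : E `<=` \bigcup_n V n.
  move=> x _; exists (Num.trunc (eucl_dist x 0)).+1 => //; exists 0 => //.
  by rewrite truncnS_gt.
move: cE; rewrite compact_cover => /(_ _ setT V (fun n _ => Vo n) EV)[F _ EVF].
pose n := \max_(j <- finmap.enum_fset F) j.
have E0 x : E x -> eucl_dist x 0 <= n%:R.
  move=> /EVF[j /= jF [_ -> xj]]; apply: le_trans (ltW xj) _.
  by rewrite ler_nat leq_bigmax_seq.
exists (n.+1%:R + n%:R); first by rewrite ltr_pwDl// ltr0n.
move=> x y Ex Ey; apply: le_trans (eucl_dist_triangle 0 _ _) _.
rewrite lerD ?(eucl_distC 0) ?E0//.
by rewrite (le_trans (E0 _ Ex))// ler_nat.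
Qed.

End copies.

(** * Copies of prescribed size and large packing sums *)

Section attractor.
Context {R : realType} {d : nat} {I : finType}.
Variables (S : I -> 'rV[R]_d -> 'rV[R]_d) (E : set 'rV[R]_d) (D : R).
Hypothesis S_sim : forall i, contracting_similarity (S i).
Hypothesis E_attractor : is_attractor S E.
Hypothesis D0 : 0 < D.
Hypothesis ED : forall x y, E x -> E y -> eucl_dist x y <= D.

(** Follow an address of [x] and stop as soon as the product of the ratios times [D] is at most [r].
    The last map shrinks by at least the smallest ratio, which gives the lower bound [c * r]. *)
Lemma attractor_copy : exists2 c : R, 0 < c < 1 &
  forall x r, E x -> 0 < r < D -> exists T rho,
    [/\ self_copy E T rho, exists2 y, E y & T y = x & c * r <= rho * D <= r].
Proof.
have [E0 cE ES] := E_attractor.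
have /choice[ratio ratioP] : forall i, exists c : R, 0 < c < 1 /\
    forall x y, eucl_dist (S i x) (S i y) = c * eucl_dist x y.
  by move=> i; have [c ? ?] := S_sim i; exists c.
have ratio0 i : 0 < ratio i by have [/andP[]] := ratioP i.
have ratio1 i : ratio i < 1 by have [/andP[]] := ratioP i.
have SE i x : E x -> E (S i x) by move=> Ex; rewrite ES; exists i => //; exists x.
have [c /andP[c0 c1] cratio] := finite_positive_lbound ratio0.
have [q /andP[q0 q1] ratioq] := finite_lt1_ubound ratio1.
exists c; first by rewrite c0.
(* [n] bounds the length of the address. The induction admits [r = D] with the identity as copy; the
   strict [r < D] of the lemma excludes ratio 1 at the end. *)
have step n x r : E x -> q ^+ n * D <= r <= D -> exists T rho,
    [/\ 0 < rho <= 1, forall x y, eucl_dist (T x) (T y) = rho * eucl_dist x y,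
      forall x, E x -> E (T x), exists2 y, E y & T y = x & c * r <= rho * D <= r].
  elim: n x r => [|n IH] x r Ex.
    rewrite expr0 mul1r => /le_anti rD; exists id, 1; split => //.
    - by rewrite ltr01 lexx.
    - by move=> y z; rewrite mul1r.
    - by exists x.
    - by rewrite mul1r -rD lexx ler_piMl// ltW.
  move=> /andP[qr rD]; have : E x by []; rewrite {1}ES => -[i _ [y Ey Sy]].
  have [rat_r|r_rat] := leP (ratio i * D) r.
    exists (S i), (ratio i); split=> //.
    - by rewrite ratio0 ltW.
    - by have [] := ratioP i.
    - exact: SE.
    - by exists y.
    - rewrite rat_r andbT; apply: ler_pM => //; first exact: ltW.
      by rewrite (le_trans _ qr)// mulr_ge0 ?exprn_ge0// ltW.
  have [|T [rho [/andP[rho0 rho1] Tsim TE [z Ez Tz] /andP[crho rhor]]]] := IH y (r / ratio i) Ey.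
    rewrite ler_pdivlMr// ler_pdivrMr// [D * _]mulrC (ltW r_rat) andbT.
    apply: (le_trans _ qr); rewrite exprSr -!mulrA ler_wpM2l ?exprn_ge0 ?(ltW q0)//.
    by rewrite mulrC ler_wpM2r// ltW.
  exists (S i \o T), (ratio i * rho); split => //.
  - by rewrite mulr_gt0 ?ratio0 //= mulr_ile1 ?(ltW (ratio0 i)) ?(ltW rho0) ?(ltW (ratio1 i)).
  - by move=> u v; have [_ Ssim] := ratioP i; rewrite /= Ssim Tsim mulrA.
  - by move=> u Eu; apply: SE; exact: TE.
  - by exists z => //=; rewrite Tz.
  - move: crho rhor; rewrite mulrA ler_pdivrMr// ler_pdivlMr//.
    by rewrite -mulrA [D * _]mulrC mulrCA mulrA => -> ->.
move=> x r Ex /andP[r0 rD].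
have rD0 : 0 < r / D by rewrite divr_gt0.
have [n qn] : exists n, q ^+ n <= r / D.
  have : (fun k => q ^+ k) @ \oo --> (0 : R).
    by apply: cvg_expr; rewrite ger0_norm// ltW.
  move=> /cvgrPdist_le/(_ _ rD0)[k _ /(_ k (leqnn k))]; rewrite sub0r normrN.
  by rewrite ger0_norm ?exprn_ge0 ?(ltW q0)// => ?; exists k.
have [|T [rho [/andP[rho0 _] Tsim TE Tx /andP[crho rhor]]]] := step n x r Ex.
  by rewrite -ler_pdivlMr// qn ltW.
exists T, rho; split => //; last by rewrite crho.
split => //; rewrite rho0/= -(ltr_pM2r D0) mul1r.
exact: le_lt_trans rD.
Qed.

(** Each ball of radius r_i receives a copy of E through its centre of diameter at most r_i / 4. Two
    copies are then at least 3/4 (r_i + r_j) apart, and r_i / 4 < D, as [attractor_copy] demands.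
    The last clause will make the copies as small as desired. *)
Lemma packing_copies : exists2 c : R, 0 < c < 1 & forall p rho, rho <= D -> packing E rho p ->
  exists T : 'I_(size p) -> 'rV[R]_d -> 'rV[R]_d, exists sigma : 'I_(size p) -> R,
    [/\ forall i, self_copy E (T i) (sigma i),
        exists2 g : R, 0 < g & forall i j x y, i != j -> E x -> E y ->
          g <= eucl_dist (T i x) (T j y),
        forall s, 0 <= s -> (c / (8 * D)) `^ s * packing_sum s p <= \sum_i sigma i `^ s
      & forall i, sigma i * D <= rho].
Proof.
have [c /andP[c0 c1] copy] := attractor_copy.
exists c; first by rewrite c0.
move=> p rho rhoD pE; pose z : 'rV[R]_d * R := (0, 0).
pose x (i : 'I_(size p)) := (nth z p i).1; pose r (i : 'I_(size p)) := (nth z p i).2.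
have Ex i : E (x i) by have [/(_ _ (mem_nth z (ltn_ord i)))[]] := pE.
have r0 i : 0 < r i by have [/(_ _ (mem_nth z (ltn_ord i)))[_ /andP[]]] := pE.
have rrho i : r i <= rho by have [/(_ _ (mem_nth z (ltn_ord i)))[_ /andP[]]] := pE.
have /choice[T] : forall i, exists T : 'rV[R]_d -> 'rV[R]_d, exists sigma,
    [/\ self_copy E T sigma, exists2 y, E y & T y = x i &
      c * (r i / 4) <= sigma * D <= r i / 4].
  move=> i; apply: copy => //; have := r0 i; have := rrho i; have := D0.
  by move=> *; apply/andP; split; lra.
move=> /choice[sigma Tsigma]; exists T, sigma.
have sigma_le i : sigma i * D <= r i / 4 by have [_ _ /andP[]] := Tsigma i.
have T_close i y : E y -> eucl_dist (x i) (T i y) <= r i / 4.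
  have [[/andP[s0 _] Tsim _] [u Eu <-] _] := Tsigma i => Ey.
  rewrite Tsim; apply: le_trans (sigma_le i); rewrite ler_wpM2l//; last exact: ED.
  exact: ltW.
split.
- by move=> i; have [] := Tsigma i.
- have [g /andP[g0 _] gr] := finite_positive_lbound r0.
  exists g => // i j y y' ij Ey Ey'.
  have /= := packing_nth z pE (ltn_ord i) (ltn_ord j) ij; rewrite -/(x i) -/(x j) -/(r i) -/(r j).
  have := eucl_dist_triangle (T i y) (x i) (x j).
  have := eucl_dist_triangle (T j y') (T i y) (x j).
  have := T_close i y Ey; have := T_close j y' Ey'; rewrite (eucl_distC (x j)).
  by have := gr i; have := gr j; lra.
- move=> s s0; rewrite /packing_sum (big_nth z) big_mkord mulr_sumr.
  apply: ler_sum => i _; rewrite -/(r i) -powRM; last 2 first.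
  + by rewrite divr_ge0 ?mulr_ge0// ltW.
  + by rewrite mulr_ge0// ltW.
  have [[/andP[sig0 _] _ _] _ /andP[csig _]] := Tsigma i.
  (* Origin of the constant: sigma_i >= c r_i / (4 D), and the packing sum counts 2 r_i. *)
  have lhsE : c / (8 * D) * (2 * r i) = c * (r i / 4) / D by field; rewrite gt_eqF.
  rewrite ge0_ler_powR ?nnegrE ?(ltW sig0)// lhsE.
    by rewrite divr_ge0 ?(ltW D0)// mulr_ge0 ?(ltW c0)// divr_ge0// ltW.
  by rewrite ler_pdivrMr.
- by move=> i; have := sigma_le i; have := r0 i; have := rrho i; lra.
Qed.

(* Otherwise the copies provided by [packing_copies] form a separated system of
   similarity dimension larger than [s], whose attractor lies in [E]. *)
Lemma packing_sum_large : exists2 K : R, 0 < K & forall s p rho,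
  0 <= s -> rho <= D -> packing E rho p -> K `^ s < packing_sum s p ->
  exists2 t, s < t & (t%:E <= dimH E)%E.
Proof.
have [E0 cE _] := E_attractor.
have [c /andP[c0 c1] copies] := packing_copies.
have K0 : 0 < c / (8 * D) by rewrite divr_gt0// mulr_gt0.
exists (c / (8 * D))^-1; first by rewrite invr_gt0.
move=> s p rho s0 rhoD pE.
have [T [sigma [TE [g g0 sep] sum_s _]]] := copies p rho rhoD pE.
have sigma0 i : 0 < sigma i by have [/andP[]] := TE i.
rewrite -powR_inv1 ?(ltW K0)// powRAC powR_inv1 ?powR_ge0// -div1r.
rewrite ltr_pdivrMr ?powR_gt0// mulrC => sum1.
have [t st sum_t] := powR_sum_gt1 sigma0 (lt_le_trans sum1 (sum_s _ s0)).
by exists t => //; exact: dimH_ge E0 cE TE g0 sep sum_t.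
Qed.

End attractor.

(** * Grids *)

Section grid.
Context {R : realType} {d : nat}.
Implicit Types (E : set 'rV[R]_d) (s rho : R).

(** The second clause is meant for colouring by residues: distinct indices with equal residues
    differ by at least m, so m - 1 whole cells lie between the two points in that coordinate. *)
Lemma grid_cell E (D h : R) : 0 < h -> 0 <= D ->
  (forall x y, E x -> E y -> eucl_dist x y <= D) ->
  exists cell : 'rV[R]_d -> {ffun 'I_d -> 'I_(Num.trunc (2 * D / h)).+1},
    (forall x y, E x -> E y -> cell x = cell y -> eucl_dist x y <= d%:R * h) /\
    (forall m x y, E x -> E y -> (forall i, cell x i = cell y i %[mod m]) ->
       cell x != cell y -> (m%:R - 1) * h <= eucl_dist x y).
Proof.
move=> h0 D0 ED; set n := Num.trunc _.
have [->|/set0P[b Eb]] := eqVneq E set0.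
  by exists (fun=> [ffun=> ord0]); split.
(* Measuring from b - D puts the coordinates of all points of E in [0, 2 D / h], the range of the
   cell indices. *)
pose a (x : 'rV[R]_d) i := (x 0 i - b 0 i + D) / h.
have a0 x i : E x -> 0 <= a x i.
  move=> Ex; rewrite divr_ge0 ?(ltW h0)//.
  have := le_trans (coord_le_eucl_dist x b i) (ED _ _ Ex Eb).
  by rewrite ler_norml => /andP[]; lra.
have an x i : E x -> (Num.trunc (a x i) < n.+1)%N.
  move=> Ex; rewrite ltnS; apply: le_truncn.
  rewrite ler_pM2r ?invr_gt0//.
  have := le_trans (coord_le_eucl_dist x b i) (ED _ _ Ex Eb).
  by rewrite ler_norml => /andP[]; lra.
pose cell x : {ffun 'I_d -> 'I_n.+1} := [ffun i => inord (Num.trunc (a x i))].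
have cellE x i : E x -> cell x i = Num.trunc (a x i) :> nat.
  by move=> Ex; rewrite ffunE inordK// an.
have aB (x y : 'rV[R]_d) i : x 0 i - y 0 i = (a x i - a y i) * h.
  by rewrite /a; field; rewrite gt_eqF.
exists cell; split=> [x y Ex Ey xy|m x y Ex Ey xym xy].
  apply: eucl_dist_le_coord => [|i]; first exact: ltW.
  rewrite aB normrM (gtr0_norm h0) ler_piMl ?(ltW h0)//.
  have /(congr1 val)/= : cell x i = cell y i by rewrite xy.
  rewrite !cellE// => xyi.
  have /andP[x1 x2] := truncn_itv (a0 _ i Ex).
  have /andP[y1 y2] := truncn_itv (a0 _ i Ey).
  move: x1 x2 y1 y2; rewrite xyi -natr1 ler_norml => *.
  by apply/andP; split; lra.
have [i xyi] : exists i, cell x i != cell y i.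
  apply/existsP; apply: contraNT xy => /existsPn xy; apply/eqP/ffunP => i.
  by apply/eqP; have := xy i; rewrite negbK.
have sep u v : E u -> E v -> (cell u i < cell v i)%N -> cell u i = cell v i %[mod m] ->
    (m%:R - 1) * h <= eucl_dist u v.
  move=> Eu Ev uv; rewrite !cellE// in uv *; move=> /eqP.
  rewrite eq_sym eqn_mod_dvd ?(ltnW uv)// => /dvdn_leq; rewrite subn_gt0 => /(_ uv).
  rewrite leq_subRL ?(ltnW uv)// -(ler_nat R) natrD => muv.
  apply: le_trans (coord_le_eucl_dist u v i); rewrite distrC aB.
  apply: le_trans (ler_norm _); rewrite ler_pM2r//.
  have /andP[x1 x2] := truncn_itv (a0 _ i Eu).
  have /andP[y1 y2] := truncn_itv (a0 _ i Ev).
  by move: x1 x2 y1 y2; rewrite -natr1; lra.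
move: xyi; rewrite neq_ltn => /orP[xyi|xyi]; first exact: sep.
by rewrite eucl_distC; apply: sep.
Qed.

Local Open Scope ereal_scope.

Lemma Phi_superadditive_sum (K : eqType) (r : seq K) (F : K -> set 'rV[R]_d) s E rho :
  (0 < rho)%R -> uniq r -> (forall k, F k `<=` E) ->
  (forall k l x y, k \in r -> l \in r -> k != l -> F k x -> F l y ->
    (rho + rho <= eucl_dist x y)%R) ->
  \sum_(k <- r) Phi s (F k) rho <= Phi s E rho.
Proof.
move=> rho0 uniqr FE sep.
pose G (r : seq K) := [set x | exists2 k, k \in r & F k x].
suff : \sum_(k <- r) Phi s (F k) rho <= Phi s (G r) rho.
  move=> /le_trans; apply; apply: Phi_mono => // x [k _ /FE]; exact: subset_closure.
elim: r uniqr sep => [_ _|k r IH]; first by rewrite big_nil Phi_ge0.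
move=> /= /andP[kr uniqr] sep; rewrite big_cons.
apply: le_trans (leeD2l _ (IH uniqr _)) _.
  by move=> i j x y ir jr; apply: sep; rewrite inE ?ir ?jr orbT.
apply: Phi_superadditive => //.
- by move=> x Fx; exists k; rewrite // mem_head.
- by move=> x [l lr Fx]; exists l; rewrite // inE lr orbT.
- move=> x y Fx [l lr Fy]; apply: (sep k l) => //; first exact: mem_head.
  + by rewrite inE lr orbT.
  + by apply: contraNneq kr => ->.
Qed.

(* Cubes of the same colour are so far apart that packings of them with radii
   at most [rho] can be put together. *)
Lemma Mdelta_le_Phi : exists N : nat, forall s rho E, (0 < rho)%R ->
  (exists D : R, forall x y, E x -> E y -> (eucl_dist x y <= D)%R) ->
  Mdelta s rho E <= N%:R%:E * Phi s E rho.
Proof.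
(* The side h = rho / (d + 1) keeps the diameter of a cell, at most d h, below [rho]. Residues
   modulo m + 1 put distinct cells of one colour at distance at least m h = 2 rho. The number of
   colours depends on d only. *)
pose m := (2 * d + 2)%N; exists #|{ffun 'I_d -> 'I_m.+1}| => s rho E rho0 [D0 ED0].
pose D := Num.max 0%R D0.
have D_ge0 : (0 <= D)%R by rewrite le_max lexx.
have ED x y : E x -> E y -> (eucl_dist x y <= D)%R.
  by move=> Ex Ey; rewrite le_max ED0// orbT.
pose h := (rho / d.+1%:R)%R.
have h0 : (0 < h)%R by rewrite divr_gt0.
have rhoE : rho = (d%:R * h + h)%R by rewrite /h -natr1; field; rewrite natr1.
have [cell [cell_diam cell_sep]] := grid_cell h0 D_ge0 ED.
pose K := {ffun 'I_d -> 'I_(Num.trunc (2 * D / h)).+1}.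
pose F (k : K) := [set x | E x /\ cell x = k].
pose colour (k : K) : {ffun 'I_d -> 'I_m.+1} := [ffun i => inord (k i %% m.+1)].
rewrite Mdelta_coverE.
apply: (@le_trans _ _ (\sum_k Phi s (F k) rho)).
  apply: (cover_outer_fin_le _ (l0 := (set0, rho)) (l := fun k => (F k, rho))).
  - by move=> [A r] /= [/andP[r0 _] _]; exact: Phi_ge0.
  - by rewrite /= rho0 lexx diam0 lee_fin ltW.
  - exact: Phi_set0.
  - move=> k; rewrite /= rho0 lexx; split => //.
    apply: diam_le => [|x y [Ex xk] [Ey yk]]; first exact: ltW.
    by apply: le_trans (cell_diam _ _ Ex Ey _) _; [rewrite xk yk|rewrite rhoE lerDl ltW].
  - by move=> x Ex; exists (cell x).
rewrite (_ : \sum_k _ = \sum_c \sum_(k | colour k == c) Phi s (F k) rho); last first.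
  by rewrite (partition_big colour xpredT).
rewrite (_ : _ * _ = \sum_(c : {ffun 'I_d -> 'I_m.+1}) Phi s E rho); last first.
  by rewrite big_const iter_addr addr0 mule_natl.
apply: lee_sum => c _.
rewrite -big_filter; apply: Phi_superadditive_sum => //.
- by rewrite filter_uniq ?index_enum_uniq.
- by move=> k x [].
move=> k l x y; rewrite !mem_filter => /andP[/eqP kc _] /andP[/eqP lc _] kl [Ex xk] [Ey yl].
rewrite (_ : rho + rho = (m.+1%:R - 1) * h)%R.
  apply: cell_sep => //; rewrite xk yl// => i.
  have /(congr1 (fun f : {ffun 'I_d -> 'I_m.+1} => val (f i))) : colour k = colour l by rewrite kc.
  by rewrite !ffunE/= !inordK ?ltn_mod.
by rewrite rhoE /m -natr1 addrK natrD natrM; ring.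
Qed.

End grid.

(** * Hausdorff and packing dimensions *)

Section dimensions.
Context {R : realType} {d : nat}.
Implicit Types (E F A : set 'rV[R]_d) (s t delta rho : R).
Local Open Scope ereal_scope.

Lemma dimH_ge0 E : 0 <= dimH E.
Proof. by apply: le_ereal_inf_tmp => _ [s [s0 _] <-]; rewrite lee_fin ltW. Qed.

Lemma hausdorff_premeasure_ge0 s delta F : 0 <= hausdorff_premeasure s delta F.
Proof. by rewrite hausdorff_premeasureE; apply: cover_outer_ge0 => U _; exact: poweR_ge0. Qed.

Lemma hausdorff_measure_eq0 s F :
  (forall delta, (0 < delta)%R -> hausdorff_premeasure s delta F <= 0) ->
  hausdorff_measure s F = 0.
Proof.
move=> le0; apply/eqP; rewrite eq_le; apply/andP; split.
  by apply: ge_ereal_sup => _ [delta /= /le0 ? <-].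
apply: le_trans (hausdorff_premeasure_ge0 s 1 F) _.
by apply: ereal_sup_ubound; exists 1%R => //=.
Qed.

Lemma hausdorff_premeasure_fin_le (J : finType) (U : J -> set 'rV[R]_d) (u s delta : R) F :
  (0 < s)%R -> (0 <= u <= delta)%R ->
  (forall x, F x -> exists j, U j x) ->
  (forall j x y, U j x -> U j y -> (eucl_dist x y <= u)%R) ->
  hausdorff_premeasure s delta F <= (#|J|%:R * u `^ s)%R%:E.
Proof.
move=> s0 /andP[u0 ud] FU Uu; rewrite hausdorff_premeasureE.
have Ud j : diam (U j) <= u%:E by apply: diam_le => // x y; exact: Uu.
apply: (@le_trans _ _ (\sum_j diam (U j) `^ s)).
  apply: (cover_outer_fin_le _ (l0 := set0)) => //.
  - by move=> V _; exact: poweR_ge0.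
  - by rewrite diam0 lee_fin (le_trans u0).
  - by rewrite diam0 poweR0r// gt_eqF.
  - by move=> j; apply: le_trans (Ud j) _; rewrite lee_fin.
apply: (@le_trans _ _ (\sum_(j : J) (u `^ s)%R%:E)).
  apply: lee_sum => j _; rewrite -poweR_EFin.
  apply: gt0_ler_poweR; rewrite ?in_itv/= ?leey ?diam_ge0 ?lee_fin ?u0 ?(ltW s0)//.
by rewrite big_const iter_addr addr0 EFinM mule_natl.
Qed.

(** This serves to make the dimension finite. The exponent d + 1 is convenient because the (n + 1)^d
    <= (2 n)^d cells of side h = 2 D / n then have total weight at most (2 n)^d (d h)^(d+1) = C / n,
    which tends to 0. *)
Lemma dimH_le_ambient E : compact E -> dimH E <= d.+1%:R%:E.
Proof.
move=> cE; have [D D0 ED] := compact_eucl_bounded cE.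
apply: ereal_inf_lbound; exists d.+1%:R%R => //; split; first by rewrite ltr0n.
apply: hausdorff_measure_eq0 => delta delta0; apply/lee_addgt0Pr => e e0; rewrite add0e.
pose C : R := (2 ^+ d * (2 * d%:R * D) ^+ d.+1)%R.
have C0 : (0 <= C)%R by rewrite mulr_ge0 ?exprn_ge0 ?mulr_ge0 ?ler0n ?(ltW D0).
pose n := (Num.trunc (C / e) + Num.trunc (2 * d%:R * D / delta)).+1.
have n0 : (0 < n%:R :> R)%R by rewrite ltr0n.
have Cn : (C / n%:R <= e)%R.
  rewrite ler_pdivrMr// [leRHS]mulrC -ler_pdivrMr//; apply/ltW/(lt_le_trans (truncnS_gt _)).
  by rewrite ler_nat ltnS leq_addr.
have dn : (2 * d%:R * D / n%:R <= delta)%R.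
  rewrite ler_pdivrMr// [leRHS]mulrC -ler_pdivrMr//; apply/ltW/(lt_le_trans (truncnS_gt _)).
  by rewrite ler_nat ltnS leq_addl.
pose h := (2 * D / n%:R)%R.
have h0 : (0 < h)%R by rewrite divr_gt0// mulr_gt0.
have dhE : (d%:R * h = 2 * d%:R * D / n%:R)%R by rewrite /h; field; rewrite gt_eqF.
have dh0 : (0 <= d%:R * h)%R by exact: mulr_ge0 (ler0n _ _) (ltW h0).
have [cell [cell_diam _]] := grid_cell h0 (ltW D0) ED.
apply: le_trans (hausdorff_premeasure_fin_le (U := fun k => [set x | E x /\ cell x = k])
  (u := (d%:R * h)%R) _ _ _ _) _.
- by rewrite ltr0n.
- by rewrite mulr_ge0 ?(ltW h0)//= dhE.
- by move=> x Ex; exists (cell x).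
- by move=> k x y [Ex xk] [Ey yk]; apply: cell_diam => //; rewrite xk yk.
rewrite lee_fin; apply: le_trans Cn.
have -> : (2 * D / h = n%:R)%R by rewrite /h; field; rewrite !gt_eqF.
rewrite natrK card_ffun !card_ord powR_mulrn//.
have -> : (C / n%:R = (n%:R * 2) ^+ d * (d%:R * h) ^+ d.+1)%R.
  rewrite /C dhE.
  rewrite expr_div_n [((_ * 2) ^+ d)%R]exprMn [(n%:R ^+ d.+1)%R]exprS.
  by field; rewrite ?expf_neq0 ?gt_eqF.
apply: ler_wpM2r; first exact: exprn_ge0.
rewrite natrX lerXn2r ?nnegrE// -natrM ler_nat.
by rewrite muln2 -addnn -addn1 leq_add2l.
Qed.

Lemma packing_content_ge0 s delta F : 0 <= packing_content s delta F.
Proof.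
apply: ereal_sup_ubound; exists 0%N, (fun=> 0%R), (fun=> 1%R).
by split=> [[]//|[]//|[]//|]; rewrite big_ord0.
Qed.

Lemma packing_premeasure_ge0 s F : 0 <= packing_premeasure s F.
Proof. by apply: le_ereal_inf_tmp => _ [delta _ <-]; exact: packing_content_ge0. Qed.

(** With radii at most delta, raising the exponent from s to s + e gains the factor (2 delta)^e.
    Hence the packing premeasure of E itself vanishes at s + e, and the constant decomposition
    suffices. *)
Lemma dimP_le s (C D : R) E : (0 <= s)%R -> (0 < D)%R ->
  (forall p rho, (rho <= D)%R -> packing E rho p -> (packing_sum s p <= C)%R) ->
  dimP E <= s%:E.
Proof.
move=> s0 D0 packC; apply/lee_addgt0Pr => e e0; rewrite -EFinD; set t := (s + e)%R.
apply: ereal_inf_lbound; exists t => //; split; first by rewrite /t ltr_wpDl.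
have C0 : (0 <= C)%R.
  by have := packC [::] D (lexx _) (packing_nil _ _); rewrite /packing_sum big_nil.
have content_le delta : (0 < delta <= D)%R ->
    packing_content t delta E <= ((2 * delta) `^ e * C)%R%:E.
  move=> /andP[delta0 deltaD]; apply: ge_ereal_sup => _ [N [x [r [Ex rd disj ->]]]].
  have sep i j : i != j -> (r i + r j <= eucl_dist (x i) (x j))%R.
    move=> /disj; apply: disjoint_closed_eball; first by have /andP[] := rd i.
    by have /andP[] := rd j.
  have [p pE psum] := packing_of_fun Ex rd sep.
  rewrite lee_fin; have := packC p delta deltaD pE; rewrite psum => sumC.
  apply: (@le_trans _ _ ((2 * delta) `^ e * \sum_(i < N) (2 * r i) `^ s)%R); last first.
    by rewrite ler_wpM2l// powR_ge0.
  rewrite mulr_sumr; apply: ler_sum => i _; have /andP[r0 rid] := rd i.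
  have r20 : (0 < 2 * r i)%R by rewrite mulr_gt0.
  rewrite /t powRD; last by rewrite (gt_eqF r20) implybT.
  rewrite mulrC ler_wpM2r ?powR_ge0// ge0_ler_powR ?nnegrE ?(ltW e0) ?(ltW r20)//.
    by rewrite mulr_ge0// ltW.
  by rewrite ler_pM2l.
have pre0 : packing_premeasure t E = 0.
  apply/eqP; rewrite eq_le packing_premeasure_ge0 andbT.
  apply/lee_addgt0Pr => eta eta0; rewrite add0e.
  (* [C + 1] because [C] may be 0; [delta] is then chosen so that (2 delta)^e <= v. *)
  pose v := (eta / (C + 1))%R; have C1 : (0 < C + 1)%R by rewrite ltr_wpDl.
  have v0 : (0 < v)%R by rewrite divr_gt0.
  pose delta := Num.min D (v `^ e^-1 / 2)%R.
  have delta0 : (0 < delta)%R by rewrite lt_min D0 divr_gt0// powR_gt0.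
  apply: (@le_trans _ _ (packing_content t delta E)).
    by apply: ereal_inf_lbound; exists delta.
  apply: le_trans (content_le delta _) _; first by rewrite delta0 ge_min lexx.
  rewrite lee_fin; apply: (@le_trans _ _ (v * C)%R).
    rewrite ler_wpM2r//; apply: (@le_trans _ _ ((v `^ e^-1) `^ e)%R).
      rewrite ge0_ler_powR ?nnegrE ?powR_ge0 ?(ltW e0) ?mulr_ge0 ?(ltW delta0)//.
      by rewrite mulrC -ler_pdivlMr// ge_min lexx orbT.
    by rewrite -powRrM mulVf ?gt_eqF// powRr1// ltW.
  by rewrite /v mulrAC ler_pdivrMr// ler_wpM2l ?(ltW eta0)// lerDl.
apply/eqP; rewrite eq_le; apply/andP; split.
  apply: ereal_inf_lbound; exists (fun=> E); split; first by move=> x Ex; exists 0%N.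
  by rewrite eseries0// => i _ _; rewrite pre0.
apply: le_ereal_inf_tmp => _ [A [_ ->]]; apply: nneseries_ge0 => j _ _.
exact: packing_premeasure_ge0.
Qed.

(* The closed balls of radius [2 * r] around the centres of a maximal packing by
   closed balls of radius [r] form a cover. *)
Lemma hausdorff_premeasure_le_packing t delta A : (0 < t)%R -> (0 < delta)%R ->
  hausdorff_premeasure t delta A <= (2 `^ t)%:E * packing_premeasure t A.
Proof.
move=> t0 delta0.
have t2 : (0 < 2 `^ t :> R)%R by rewrite powR_gt0.
rewrite muleC -lee_pdivrMr//; apply: le_ereal_inf_tmp => _ [eta /= eta0 <-].
rewrite lee_pdivrMr//.
have [->|cfin] := eqVneq (packing_content t eta A) +oo.
  by rewrite mulyr gtr0_sg// mul1e leey.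
have {}cfin : packing_content t eta A \is a fin_num.
  by rewrite ge0_fin_numE ?packing_content_ge0// lt_neqAle cfin leey.
pose c := fine (packing_content t eta A).
have cE : packing_content t eta A = c%:E by rewrite fineK.
pose r := Num.min (delta / 4)%R eta.
have r0 : (0 < r)%R by rewrite lt_min divr_gt0.
pose net (p : seq 'rV[R]_d) := (forall x, x \in p -> A x) /\
  pairwise (fun x y => 2 * r < eucl_dist x y)%R p.
have net_size p : net p -> ((size p)%:R * (2 * r) `^ t <= c)%R.
  move=> [pA psep]; rewrite -lee_fin -cE; apply: ereal_sup_ubound.
  exists (size p), (fun i => nth 0%R p i), (fun=> r); split.
  - by move=> i; apply: pA; exact: mem_nth.
  - by move=> i; rewrite r0 ge_min lexx orbT.
  - move=> i j ij.
    have sep : (2 * r < eucl_dist (nth 0%R p i) (nth 0%R p j))%R.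
      move: ij; rewrite neq_ltn => /orP[ij|ij]; last rewrite eucl_distC;
        by move/(pairwiseP 0%R): psep; apply; rewrite ?inE.
    apply/seteqP; split=> z // [xz yz]; move: sep; rewrite ltNge => /negP; apply.
    apply: le_trans (eucl_dist_triangle z _ _) _.
    by rewrite (eucl_distC z) mulr_natl mulr2n lerD.
  - by rewrite sumr_const card_ord mulr_natl.
have [n netn maxn] : exists2 n, (exists2 p, net p & size p = n) &
    forall p, net p -> (size p <= n)%N.
  pose P n := `[< exists2 p, net p & size p = n >].
  have P0 : exists n, P n by exists 0%N; apply/asboolP; exists [::].
  have Pb n : P n -> (n <= Num.trunc (c / (2 * r) `^ t))%N.
    have rt0 : (0 < (2 * r) `^ t)%R by rewrite powR_gt0// mulr_gt0.
    move=> /asboolP[p /net_size pc <-]; move: pc; rewrite -ler_pdivlMr// => pc.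
    by rewrite truncn_ge_nat// (le_trans _ pc).
  case: (ex_maxnP P0 Pb) => n /asboolP Pn maxn; exists n => // p netp.
  by apply: maxn; apply/asboolP; exists p.
have [p netp pn] := netn.
apply: le_trans (hausdorff_premeasure_fin_le (J := 'I_(size p))
  (U := fun i => closed_eball (nth 0%R p i) (2 * r)) (u := 4 * r) t0 _ _ _) _.
- by rewrite mulr_ge0 ?(ltW r0)//= mulrC -ler_pdivlMr// ge_min lexx.
- move=> x Ax; apply: contrapT => none.
  suff /maxn : net (x :: p) by rewrite /= pn ltnn.
  have [pA psep] := netp; split; first by move=> y; rewrite inE => /predU1P[->|/pA].
  rewrite pairwise_cons psep andbT; apply/(all_nthP 0%R) => i ip.
  rewrite ltNge; apply/negP => xi; apply: none; exists (Ordinal ip).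
  by rewrite /closed_eball/= eucl_distC.
- move=> i x y xi yi; apply: le_trans (eucl_dist_triangle (nth 0%R p i) _ _) _.
  by rewrite (eucl_distC x); move: xi yi; rewrite /closed_eball/=; lra.
rewrite card_ord cE -EFinM lee_fin mulrC.
have -> : (4 * r = 2 * (2 * r))%R by ring.
rewrite powRM ?mulr_ge0 ?(ltW r0)// -mulrA mulrC ler_wpM2r ?(ltW t2)// mulrC.
exact: net_size.
Qed.

(** A decomposition of small total packing premeasure has, piece by piece, small Hausdorff
    premeasure at every scale, and the pieces add up by countable subadditivity. *)
Lemma dimH_le_dimP F : dimH F <= dimP F.
Proof.
apply: ereal_inf_le_tmp => _ [t [t0 Pt0] <-]; exists t => //; split => //.
apply: hausdorff_measure_eq0 => delta delta0.
have t2 : (0 < 2 `^ t :> R)%R by rewrite powR_gt0.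
apply/lee_addgt0Pr => e e0; rewrite add0e.
have : packing_measure t F < (e / 2 `^ t)%:E by rewrite Pt0 lte_fin divr_gt0.
move=> /ereal_inf_lt[_ [A [FA ->]] /ltW Ae].
have := @cover_outer_subadditive R 'rV[R]_d _ (fun U => diam U <= delta%:E) id
  (fun U => diam U `^ t).
rewrite -hausdorff_premeasureE => /(_ (fun U _ => poweR_ge0 _ _) _ _ FA) /le_trans; apply.
apply: (@le_trans _ _ (\sum_(0 <= k <oo) (2 `^ t)%:E * packing_premeasure t (A k))).
  apply: lee_nneseries => [k _ _|k _]; first exact: hausdorff_premeasure_ge0.
  exact: hausdorff_premeasure_le_packing.
rewrite nneseriesZl; last by move=> k _; exact: packing_premeasure_ge0.
by rewrite muleC -lee_pdivlMr.
Qed.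

End dimensions.

(** * Metric outer measures *)

Section metric_outer_measure.
Context {R : realType} {d : nat}.
Variable mu : set 'rV[R]_d -> \bar R.
Local Open Scope ereal_scope.
Hypothesis mu_ge0 : forall A, 0 <= mu A.
Hypothesis mu0 : mu set0 = 0.
Hypothesis mu_sub : countably_subadditive mu.
Hypothesis mu_metric : forall A B (g : R), (0 < g)%R ->
  (forall x y, A x -> B y -> (g <= eucl_dist x y)%R) -> mu A + mu B <= mu (A `|` B).

Lemma metric_outer_mono A B : A `<=` B -> mu A <= mu B.
Proof.
move=> AB; rewrite -[leRHS]adde0 -mu0; apply: subadditiveU => // x /AB; by left.
Qed.

Lemma metric_outer_sum (K : eqType) (r : seq K) (F : K -> set 'rV[R]_d) A (g : R) :
  (0 < g)%R -> uniq r -> (forall k, F k `<=` A) ->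
  (forall k l x y, k \in r -> l \in r -> k != l -> F k x -> F l y ->
    (g <= eucl_dist x y)%R) ->
  \sum_(k <- r) mu (F k) <= mu A.
Proof.
move=> g0 uniqr FA sep.
pose G (r : seq K) := [set x | exists2 k, k \in r & F k x].
suff : \sum_(k <- r) mu (F k) <= mu (G r).
  by move=> /le_trans; apply; apply: metric_outer_mono => x [k _ /FA].
elim: r uniqr sep => [_ _|k r IH]; first by rewrite big_nil.
move=> /= /andP[kr uniqr] sep; rewrite big_cons.
apply: le_trans (leeD2l _ (IH uniqr _)) _.
  by move=> i j x y ir jr; apply: sep; rewrite inE ?ir ?jr orbT.
apply: le_trans (mu_metric g0 _) _.
  move=> x y Fx [l lr Fy]; apply: (sep k l) => //; first exact: mem_head.
    by rewrite inE lr orbT.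
  by apply: contraNneq kr => ->.
apply: metric_outer_mono => x [Fx|[l lr Fx]]; first by exists k; rewrite // mem_head.
by exists l; rewrite // inE lr orbT.
Qed.

(* Carathéodory's argument: [N n] increases to [E `\` K], and the layers
   [N n.+2 `\` N n.+1] with [n] of a given parity are positively separated. *)
Lemma metric_outer_split E K : mu E < +oo -> K `<=` E ->
  (forall x, E x -> ~ K x ->
    exists2 g : R, (0 < g)%R & forall y, K y -> (g <= eucl_dist x y)%R) ->
  mu (E `\` K) + mu K <= mu E.
Proof.
move=> Efin KE Kclosed.
pose N n := [set x | E x /\ forall y, K y -> ((n.+1%:R)^-1 <= eucl_dist x y)%R].
have NE n : N n `<=` E by move=> x [].
have N_mono m n : (m <= n)%N -> N m `<=` N n.
  move=> mn x [Ex Nx]; split=> // y /Nx; apply: le_trans.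
  by rewrite lef_pV2 ?posrE// ler_nat.
have Nsep n x y : N n x -> E y -> ~ N n.+1 y ->
    ((n.+1%:R)^-1 - (n.+2%:R)^-1 <= eucl_dist x y)%R.
  move=> [Ex Nx] Ey Ny.
  have [z Kz yz] : exists2 z, K z & (eucl_dist y z < (n.+2%:R)^-1)%R.
    apply: contrapT => none; apply: Ny; split=> // z Kz; rewrite leNgt; apply/negP => yz.
    by apply: none; exists z.
  rewrite lerBlDr; apply: le_trans (Nx z Kz) _.
  by apply: le_trans (eucl_dist_triangle y _ _) _; rewrite lerD2l ltW.
have gap n : (0 < (n.+1%:R)^-1 - (n.+2%:R)^-1 :> R)%R.
  by rewrite subr_gt0 ltf_pV2 ?posrE// ltr_nat.
(* [N n.+1] is left out as a buffer: points of [L n] are at distance at least 1/(n+1) - 1/(n+2) from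
   [N n], hence from all layers [L k] with k + 2 <= n. *)
pose L n := N n.+2 `\` N n.+1.
have LE n : L n `<=` E by move=> x [/NE].
have L_sum b n : \sum_(i < n) mu (L (2 * i + b)%N) <= mu (N (2 * n + b)%N).
  elim: n => [|n IH]; first by rewrite big_ord0.
  rewrite big_ord_recr/=; apply: le_trans (leeD2r _ IH) _.
  apply: le_trans (mu_metric (gap (2 * n + b)%N) _) _.
    by move=> x y Nx [/NE Ey]; exact: Nsep.
  apply: metric_outer_mono => x [|[]]; last by rewrite mulnS.
  by apply: N_mono; rewrite leq_add2r leq_mul2l leqnSn orbT.
have L_series b : \sum_(0 <= i <oo) mu (L (2 * i + b)%N) <= mu E.
  apply: lime_le; first by apply: is_cvg_nneseries.
  by near=> n; rewrite big_mkord (le_trans (L_sum b n))// metric_outer_mono.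
pose G i := L (2 * i + 0)%N `|` L (2 * i + 1)%N.
have G_series : \sum_(0 <= i <oo) mu (G i) < +oo.
  apply: (@le_lt_trans _ _ (mu E + mu E)); last by rewrite lte_add_pinfty.
  apply: le_trans (leeD (L_series 0%N) (L_series 1%N)).
  rewrite -nneseriesD//; apply: lee_nneseries => // i _.
  exact: subadditiveU.
apply/lee_addgt0Pr => e e0.
have [n tail_n] : exists n, \sum_(n <= i <oo) mu (G i) <= e%:E.
  have /(_ (fun _ _ => mu_ge0 _)) := nneseries_tail_cvg G_series.
  move=> /(_ [set y | y < e%:E])[|n _ /(_ n (leqnn n)) tail_n].
    by apply: open_ereal_lt'; rewrite lte_fin.
  by exists n; exact: ltW.
have split_n : mu (E `\` K) <= mu (N (2 * n + 1)%N) + e%:E.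
  pose C := \bigcup_i G (i + n)%N.
  have Ce : mu C <= e%:E.
    apply: le_trans tail_n; rewrite -nneseries_addn//.
    exact: (mu_sub (F := fun i => G (i + n)%N)).
  apply: le_trans (leeD2l _ Ce); apply: subadditiveU => // x [Ex Kx].
  have [g g0 gK] := Kclosed x Ex Kx.
  pose m := Num.trunc g^-1.
  have Nm k : (m <= k)%N -> N k x.
    move=> mk; split=> // y /gK; apply: le_trans.
    rewrite invf_ple ?posrE//; apply/ltW/(lt_le_trans (truncnS_gt _)).
    by rewrite ler_nat ltnS.
  have [Nx|Nx] := pselect (N (2 * n + 1)%N x); [by left|right].
  (* The moment when [x] enters the increasing sets [N]. It puts [x] in the layer of index k - 1 >=
     2 n, which belongs to the tail [C]. *)
  have [k nk [Nk NSk]] : exists2 k, (2 * n + 1 <= k)%N & ~ N k x /\ N k.+1 x.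
    apply: contrapT => none.
    have notN k : ~ N (2 * n + 1 + k)%N x.
      elim: k => [|k IH]; first by rewrite addn0.
      rewrite addnS => NSk; apply: none; exists (2 * n + 1 + k)%N; rewrite ?leq_addr//.
    by apply: (notN m); apply: Nm; rewrite leq_addl.
  have [kE k0] : k = k.-1.+1 /\ (2 * n <= k.-1)%N by move: nk; lia.
  have Lx : L k.-1 x by split; rewrite -?kE.
  exists (k.-1./2 - n)%N => //; rewrite /G subnK; last first.
    by rewrite -(half_bit_double n false) add0n half_leq// -muln2 mulnC.
  have := odd_double_half k.-1; rewrite -mul2n addnC => kk.
  by case: (odd k.-1) kk => kk; [right|left]; rewrite kk.
apply: le_trans (leeD2r _ split_n) _; rewrite addeAC leeD2r//.
have n0 : (0 < (2 * n + 1).+1%:R^-1 :> R)%R by rewrite invr_gt0.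
apply: le_trans (mu_metric n0 _) _; first by move=> x y [_]; exact.
by apply: metric_outer_mono => x [/NE|/KE].
Unshelve. all: by end_near. Qed.

End metric_outer_measure.

(** * [Mdelta] and [Mlim] as outer measures *)

Section labelled_measure.
Context {R : realType} {d : nat}.
Implicit Types (A B E F : set 'rV[R]_d) (s delta rho : R).
Local Open Scope ereal_scope.

Lemma Mdelta_ge0 s delta F : 0 <= Mdelta s delta F.
Proof.
rewrite Mdelta_coverE; apply: cover_outer_ge0 => l [/andP[l0 _] _]; exact: Phi_ge0.
Qed.

Lemma Mdelta_subadditive s delta : countably_subadditive (@Mdelta R d s delta).
Proof.
rewrite Mdelta_coverE; apply: cover_outer_subadditive => l [/andP[l0 _] _].
exact: Phi_ge0.
Qed.

Lemma Mdelta_le_Phi1 s delta A rho : (0 < rho <= delta)%R -> diam A <= rho%:E ->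
  Mdelta s delta A <= Phi s A rho.
Proof.
move=> /andP[rho0 rhod] Arho; rewrite Mdelta_coverE.
rewrite [leRHS](_ : _ = \sum_(j : unit) Phi s A rho); last by rewrite big_const card_unit /= addr0.
apply: (cover_outer_fin_le _ (l0 := (set0, rho)) (l := fun _ : unit => (A, rho))).
- by move=> l [/andP[l0 _] _]; exact: Phi_ge0.
- by rewrite /= rho0 rhod diam0 lee_fin ltW.
- exact: Phi_set0.
- by move=> _; rewrite /= rho0 rhod.
- by move=> x Ax; exists tt.
Qed.

Lemma Mdelta0 s delta : (0 < delta)%R -> Mdelta s delta (set0 : set 'rV[R]_d) = 0.
Proof.
move=> delta0; apply/eqP; rewrite eq_le Mdelta_ge0 andbT -(Phi_set0 (d := d) s delta).
by apply: Mdelta_le_Phi1; rewrite ?delta0 ?lexx// diam0 lee_fin ltW.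
Qed.

Lemma Mdelta_le_Mlim s delta F : (0 < delta)%R -> Mdelta s delta F <= Mlim s F.
Proof.
move=> delta0; apply: (@le_trans _ _ (Mdelta s (Num.min delta 2^-1)%R F)).
  by apply: Mdelta_anti; rewrite ge_min lexx.
rewrite MlimE; apply: ereal_sup_ubound; exists (Num.min delta 2^-1)%R => //=.
by rewrite lt_min delta0 invr_gt0 ltr0n/= gt_min invf_lt1// ltr1n orbT.
Qed.

Lemma Mlim_le s F (v : \bar R) :
  (forall delta, (0 < delta)%R -> Mdelta s delta F <= v) -> Mlim s F <= v.
Proof.
move=> Fv; rewrite MlimE; apply: ge_ereal_sup => _ [delta /= /andP[delta0 _] <-].
exact: Fv.
Qed.

Lemma Mlim_ge0 s F : 0 <= Mlim s F.
Proof. exact: le_trans (Mdelta_ge0 s 1 F) (Mdelta_le_Mlim _ _ _). Qed.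

Lemma Mlim0 s : Mlim s (set0 : set 'rV[R]_d) = 0.
Proof.
apply/eqP; rewrite eq_le Mlim_ge0 andbT; apply: Mlim_le => delta delta0.
by rewrite Mdelta0.
Qed.

Lemma Mlim_subadditive s : countably_subadditive (@Mlim R d s).
Proof.
move=> A F AF; apply: Mlim_le => delta delta0.
apply: le_trans (@Mdelta_subadditive s delta _ _ AF) _.
by apply: lee_nneseries => [k _ _|k _]; [exact: Mdelta_ge0|exact: Mdelta_le_Mlim].
Qed.

(** A covering set has diameter at most delta < g, so it meets at most one of A and B; cutting the
    cover with A and with B, with labels unchanged, splits its cost. *)
Lemma Mdelta_metric s delta A B (g : R) : (delta < g)%R ->
  (forall x y, A x -> B y -> (g <= eucl_dist x y)%R) ->
  Mdelta s delta A + Mdelta s delta B <= Mdelta s delta (A `|` B).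
Proof.
move=> dg ABg; apply: le_ereal_inf_tmp => _ [U [rho [[ABU Urho] rhod ->]]].
have rho0 j : (0 < rho j)%R by have [] := Urho j.
have cover C : C `<=` A `|` B -> Mdelta s delta C <= \sum_(0 <= j <oo) Phi s (U j `&` C) (rho j).
  move=> CAB; apply: ereal_inf_lbound; exists (fun j => U j `&` C), rho; split=> //.
  split=> [x Cx|j]; first by have [j _ Ux] := ABU _ (CAB _ Cx); exists j.
  by split=> //; have [_] := Urho j; apply: diam_mono.
have Phi_ge0' C j : 0 <= Phi s (U j `&` C) (rho j) by exact: Phi_ge0.
apply: le_trans (leeD (cover A _) (cover B _)) _.
- by move=> x; left.
- by move=> x; right.
rewrite -nneseriesD//; apply: lee_nneseries => [j _ _|j _]; first exact: adde_ge0.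
have UI C : Phi s (U j `&` C) (rho j) <= Phi s (U j) (rho j).
  by apply: Phi_mono => // x [Ux _]; exact: subset_closure.
have [UA|/set0P[x [Ux Ax]]] := eqVneq (U j `&` A) set0; first by rewrite UA Phi_set0 add0e.
have -> : U j `&` B = set0; last by rewrite Phi_set0 adde0.
apply/seteqP; split=> // y [Uy By].
have := ABg x y Ax By; rewrite leNgt => /negP; apply.
apply: le_lt_trans dg; apply: le_trans (rhod j).
by have [_ Ud] := Urho j; exact: eucl_dist_le_diam Ud _ _.
Qed.

Lemma Mlim_metric s A B (g : R) : (0 < g)%R ->
  (forall x y, A x -> B y -> (g <= eucl_dist x y)%R) ->
  Mlim s A + Mlim s B <= Mlim s (A `|` B).
Proof.
move=> g0 ABg.
(* Independent scales allow the two suprema to be taken in turn; [g / 2] keeps the common scale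
   below the gap. *)
have H a b : (0 < a)%R -> (0 < b)%R -> Mdelta s a A + Mdelta s b B <= Mlim s (A `|` B).
  move=> a0 b0; pose c := Num.min (Num.min a b) (g / 2)%R.
  have c0 : (0 < c)%R by rewrite !lt_min a0 b0 divr_gt0.
  apply: (@le_trans _ _ (Mdelta s c A + Mdelta s c B)).
    by apply: leeD; apply: Mdelta_anti; rewrite !ge_min lexx ?orbT.
  apply: le_trans (Mdelta_metric s (g := g) _ ABg) (Mdelta_le_Mlim _ _ c0).
  by rewrite gt_min ltr_pdivrMr// ltr_pMr// ltr1n orbT.
have [->|AB_fin] := eqVneq (Mlim s (A `|` B)) +oo; first by rewrite leey.
have ABf : Mlim s (A `|` B) \is a fin_num by rewrite ge0_fin_numE ?Mlim_ge0// lt_neqAle AB_fin leey.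
have fin F : Mlim s F <= Mlim s (A `|` B) -> Mlim s F \is a fin_num.
  by move=> FAB; rewrite ge0_fin_numE ?Mlim_ge0//; apply: le_lt_trans FAB _; rewrite ltey_eq ABf.
have MB a : (0 < a)%R -> Mlim s B <= Mlim s (A `|` B) - Mdelta s a A.
  move=> a0; have Aa : Mdelta s a A \is a fin_num.
    rewrite ge0_fin_numE ?Mdelta_ge0//; apply: (@le_lt_trans _ _ (Mlim s (A `|` B))).
      by apply: le_trans (H a 1%R a0 ltr01); rewrite leeDl// Mdelta_ge0.
    by rewrite ltey_eq ABf.
  by apply: Mlim_le => b b0; rewrite leeBrDr// addeC H.
have Bf : Mlim s B \is a fin_num.
  apply/fin/(le_trans (MB 1%R ltr01)); rewrite -[leRHS]sube0 leeB// Mdelta_ge0//.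
rewrite -leeBrDr//; apply: Mlim_le => a a0; rewrite leeBrDr// addeC.
have := MB a a0; rewrite leeBrDr//.
rewrite ge0_fin_numE ?Mdelta_ge0//; apply: (@le_lt_trans _ _ (Mlim s (A `|` B))).
  by apply: le_trans (H a 1%R a0 ltr01); rewrite leeDl// Mdelta_ge0.
by rewrite ltey_eq ABf.
Qed.

End labelled_measure.

(** * Similarities and packings *)

Section similarity_scaling.
Context {R : realType} {d : nat}.
Implicit Types (A B E F : set 'rV[R]_d) (s delta rho : R).
Variables (T : 'rV[R]_d -> 'rV[R]_d) (c : R).
Hypothesis c0 : 0 < c.
Hypothesis T_sim : forall x y, eucl_dist (T x) (T y) = c * eucl_dist x y.

Lemma similarity_continuous : continuous T.
Proof.
move=> x A /nbhs_eballP[e e0 eA]; apply/nbhs_eballP; exists (e / c).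
  exact: divr_gt0.
by move=> y /= xy; apply: eA; rewrite /= T_sim mulrC -ltr_pdivlMr.
Qed.

Lemma similarity_image_compact A : compact A -> compact (T @` A).
Proof.
by apply: continuous_compact; apply: continuous_subspaceT; exact: similarity_continuous.
Qed.

Definition packing_map (p : seq ('rV[R]_d * R)) := [seq (T q.1, c * q.2) | q <- p].

Lemma packing_mapP A rho p : packing A rho p <-> packing (T @` A) (c * rho) (packing_map p) /\
  (forall q, q \in p -> A q.1).
Proof.
split=> [[pA psep]|[[pA psep] qA]]; split.
- split=> [_ /mapP[q /pA[Aq /andP[q0 qr]] ->]|].
    by split; [exists q.1|rewrite /= mulr_gt0//= ler_pM2l].
  by rewrite pairwise_map; apply: sub_pairwise psep => q q' /=; rewrite T_sim -mulrDr ler_pM2l.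
- by move=> q /pA[].
- move=> q qp; split; first exact: qA.
  have [_] := pA _ (map_f (fun q => (T q.1, c * q.2)) qp).
  by rewrite /= pmulr_rgt0// ler_pM2l.
- move: psep; rewrite pairwise_map; apply: sub_pairwise => q q' /=.
  by rewrite T_sim -mulrDr ler_pM2l.
Qed.

Lemma packing_sum_map s p rho A : packing A rho p ->
  packing_sum s (packing_map p) = c `^ s * packing_sum s p.
Proof.
move=> [pA _]; rewrite /packing_sum big_map mulr_sumr.
rewrite [LHS]big_seq [RHS]big_seq; apply: eq_bigr => q /pA[_ /andP[q0 _]] /=.
have q20 : 0 <= 2 * q.2 by rewrite mulr_ge0// ltW.
by rewrite mulrCA (powRM s (ltW c0) q20).
Qed.

Local Open Scope ereal_scope.

(** Used to pull a cover of an image back to a cover of the set, with labels divided by [c]. *)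
Lemma Phi_preimage_le s A rho : (0 < rho)%R ->
  (c `^ s)%:E * Phi s (T @^-1` A) (rho / c) <= Phi s A rho.
Proof.
move=> rho0; have cs0 : (0 < c `^ s)%R by rewrite powR_gt0.
rewrite muleC -lee_pdivlMr//; apply: Phi_le => [|p pA].
  by rewrite mule_ge0 ?Phi_ge0// lee_fin invr_ge0 ltW.
rewrite lee_pdivlMr// muleC -EFinM -(packing_sum_map s pA).
apply: packing_sum_le_Phi => //; have [pTA _] := (packing_mapP _ _ _).1 pA.
have crho : (c * (rho / c) <= rho)%R by rewrite mulrC divfK ?gt_eqF.
apply: packing_mono crho pTA => _ [x clx <-]; apply/closure_eucl => e e0.
have [y Ay xy] := closure_close clx (divr_gt0 e0 c0).
by exists (T y) => //; rewrite T_sim mulrC -ltr_pdivlMr.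
Qed.

(** Compactness makes the image closed, so every centre of a packing is the image of a point of A,
    and the packing is pulled back by a chosen inverse [T']. *)
Lemma Phi_image_le s A rho : compact A -> (0 < rho)%R ->
  Phi s (T @` A) (c * rho) <= (c `^ s)%:E * Phi s A rho.
Proof.
move=> cA rho0; apply: Phi_le => [|p pTA].
  by rewrite mule_ge0 ?Phi_ge0// lee_fin powR_ge0.
have {}pTA : packing (T @` A) (c * rho) p.
  move: pTA; rewrite -((closure_id _).1 _)//.
  by apply: compact_closed; [exact: rV_hausdorff|exact: similarity_image_compact].
pose T' x := xget 0%R [set y | A y /\ T y = x].
have T'P x : (T @` A) x -> A (T' x) /\ T (T' x) = x.
  by move=> [y Ay Ty]; apply: (@xgetPex _ 0%R [set y | A y /\ T y = x]); exists y.
pose p' := [seq (T' q.1, (q.2 / c)%R) | q <- p].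
have pE : packing_map p' = p.
  rewrite /packing_map /p' -map_comp -[RHS]map_id; apply/eq_in_map => q qp /=.
  have [pA _] := pTA; have [/T'P[_ ->] _] := pA q qp.
  by rewrite mulrC divfK ?gt_eqF//; case: (q).
have p'A : packing A rho p'.
  apply/packing_mapP; rewrite pE; split=> // _ /mapP[q qp ->] /=.
  by have [pA _] := pTA; have [/T'P[]] := pA q qp.
rewrite -pE (packing_sum_map s p'A) EFinM lee_pmul2l ?lte_fin ?powR_gt0//.
apply: packing_sum_le_Phi => //; apply: packing_mono (lexx _) p'A; exact: subset_closure.
Qed.

Lemma Mlim_image_ge s F : (c `^ s)%:E * Mlim s F <= Mlim s (T @` F).
Proof.
have cs0 : (0 < c `^ s)%R by rewrite powR_gt0.
rewrite muleC -lee_pdivlMr//; apply: Mlim_le => delta delta0.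
rewrite lee_pdivlMr// muleC.
apply: le_trans (Mdelta_le_Mlim s (T @` F) (mulr_gt0 c0 delta0)).
apply: le_ereal_inf_tmp => _ [A [rho [[TFA Arho] rhod ->]]].
have rho0 j : (0 < rho j)%R by have [] := Arho j.
apply: (@le_trans _ _ (\sum_(0 <= j <oo) (c `^ s)%:E * Phi s (T @^-1` A j) (rho j / c))).
  rewrite nneseriesZl => [|j _]; last by apply: Phi_ge0; exact: divr_gt0.
  rewrite lee_pmul2l ?lte_fin//; apply: ereal_inf_lbound.
  exists (fun j => T @^-1` A j), (fun j => (rho j / c)%R); split=> //.
    split=> [x Fx|j].
      by have [|j _ Ax] := TFA (T x); [exists x|exists j].
    split; first exact: divr_gt0.
    apply: diam_le => [|x y Ax Ay]; first by rewrite ltW// divr_gt0.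
    rewrite ler_pdivlMr// mulrC -T_sim.
    by have [_ Ad] := Arho j; exact: eucl_dist_le_diam Ad Ax Ay.
  by move=> j; rewrite ler_pdivrMr// mulrC.
apply: lee_nneseries => [j _ _|j _]; last exact: Phi_preimage_le.
by rewrite mule_ge0 ?lee_fin ?powR_ge0//; apply: Phi_ge0; exact: divr_gt0.
Qed.

End similarity_scaling.

(** * Self-similar attractors *)

Section attractor_measure.
Context {R : realType} {d : nat} {I : finType}.
Variables (S : I -> 'rV[R]_d -> 'rV[R]_d) (E : set 'rV[R]_d) (D s : R).
Hypothesis S_sim : forall i, contracting_similarity (S i).
Hypothesis E_attractor : is_attractor S E.
Hypothesis D0 : 0 < D.
Hypothesis ED : forall x y, E x -> E y -> eucl_dist x y <= D.
Hypothesis s_ge0 : 0 <= s.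
Hypothesis dimHE : dimH E = s%:E.

Let E_compact : compact E. Proof. by case: E_attractor. Qed.

Let E_closure : closure E = E.
Proof.
by apply/esym/closure_id; apply: compact_closed E_compact; exact: rV_hausdorff.
Qed.

Lemma attractor_packing_bounded : exists C : R,
  forall p rho, rho <= D -> packing E rho p -> packing_sum s p <= C.
Proof.
have [K K0 large] := packing_sum_large S_sim E_attractor D0 ED.
exists (K `^ s) => p rho rhoD pE; rewrite leNgt; apply/negP => /(large _ _ _ s_ge0 rhoD pE).
by move=> [t st]; rewrite dimHE lee_fin leNgt st.
Qed.

Lemma attractor_dimP : dimP E = s%:E.
Proof.
have [C packC] := attractor_packing_bounded.
by apply/eqP; rewrite eq_le (dimP_le s_ge0 D0 packC) -dimHE dimH_le_dimP.
Qed.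

Lemma attractor_dim_gt0 : ~ (exists x, E = [set x]) -> 0 < s.
Proof.
move=> nonsingleton; have [[x Ex] _ _] := E_attractor.
have [y Ey yx] : exists2 y, E y & y != x.
  apply: contrapT => none; apply: nonsingleton; exists x; apply/seteqP; split=> y /=.
    by move=> Ey; apply: contrapT => yx; apply: none; exists y => //; exact/eqP.
  by move=> ->.
have xy0 : 0 < eucl_dist x y.
  rewrite lt_neqAle eucl_dist_ge0 andbT; apply/eqP => /esym /eucl_dist_eq0 xy.
  by rewrite xy eqxx in yx.
have [K K0 large] := packing_sum_large S_sim E_attractor D0 ED.
pose r := eucl_dist x y / 2.
have r0 : 0 < r by rewrite divr_gt0.
have pE : packing E r [:: (x, r); (y, r)].
  split=> [q|]; first by rewrite !inE => /orP[/eqP->|/eqP->]; rewrite /= r0 lexx.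
  by rewrite pairwise2 /= /r -splitr.
have rD : r <= D.
  by rewrite ler_pdivrMr// (le_trans (ED Ex Ey))// ler_peMr ?ler1n// ltW.
have [|t t0] := large _ _ _ (lexx 0) rD pE.
  (* At exponent 0 the threshold is K^0 = 1, whatever [K] is, and two balls have sum 2. *)
  by rewrite powRr0 /packing_sum !big_cons big_nil /= !powRr0 addr0 ltrDl.
by rewrite dimHE lee_fin; exact: lt_le_trans.
Qed.

Local Open Scope ereal_scope.

Lemma attractor_Mlim_lty : Mlim s E < +oo.
Proof.
have [C packC] := attractor_packing_bounded.
have [N MN] := @Mdelta_le_Phi R d.
have C0 : (0 <= C)%R.
  by have := packC [::] D (lexx _) (packing_nil _ _); rewrite /packing_sum big_nil.
apply: (@le_lt_trans _ _ (N%:R * C)%R%:E); last exact: ltry.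
apply: Mlim_le => delta delta0; pose rho := Num.min delta D.
have rho0 : (0 < rho)%R by rewrite lt_min delta0.
apply: (@le_trans _ _ (Mdelta s rho E)); first by apply: Mdelta_anti; rewrite ge_min lexx.
apply: le_trans (MN _ _ _ rho0 _) _; first by exists D.
rewrite EFinM lee_wpmul2l ?lee_fin//; apply: Phi_le => [|p]; first by rewrite lee_fin.
by rewrite E_closure lee_fin; apply: packC; rewrite ge_min lexx orbT.
Qed.

(** The grid bound read backwards: N Phi(E, rho) >= M_rho(E) >= M_delta0(E) > 0 for all rho <=
    delta0, so the lower bound is uniform in the scale. *)
Lemma attractor_packing_large : 0 < Mlim s E ->
  exists2 c : R, (0 < c)%R & forall rho, (0 < rho)%R ->
    exists2 p, packing E rho p & (c < packing_sum s p)%R.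
Proof.
have [N MN] := @Mdelta_le_Phi R d.
rewrite MlimE => /ereal_sup_gt[_ [delta0 /= /andP[delta0_gt0 _] <-]].
set m := Mdelta s delta0 E => m0.
have mfin : m \is a fin_num.
  rewrite ge0_fin_numE ?ltW//; apply: le_lt_trans attractor_Mlim_lty.
  exact: Mdelta_le_Mlim.
have mE : m = (fine m)%:E by rewrite fineK.
have fm0 : (0 < fine m)%R by rewrite -lte_fin -mE.
(* [N.+1] makes N times this constant strictly smaller than [m] and avoids a division by 0. *)
exists (fine m / N.+1%:R)%R; first exact: divr_gt0.
have large rho : (0 < rho <= delta0)%R ->
    exists2 p, packing E rho p & (fine m / N.+1%:R < packing_sum s p)%R.
  move=> /andP[rho0 rhod]; apply: contrapT => none.
  suff : m < m by rewrite ltxx.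
  apply: (@le_lt_trans _ _ (N%:R%:E * (fine m / N.+1%:R)%R%:E)); last first.
    rewrite -EFinM [ltRHS]mE lte_fin mulrCA gtr_pMr// ltr_pdivrMr// mul1r ltr_nat//.
  apply: (@le_trans _ _ (Mdelta s rho E)); first exact: Mdelta_anti.
  apply: le_trans (MN _ _ _ rho0 _) _; first by exists D.
  rewrite lee_wpmul2l ?lee_fin//; apply: Phi_le => [|p]; first by rewrite lee_fin divr_ge0// ltW.
  rewrite E_closure lee_fin => pE; rewrite leNgt; apply/negP => mp.
  by apply: none; exists p.
move=> rho rho0; have [|p pE mp] := large (Num.min rho delta0).
  by rewrite lt_min rho0 delta0_gt0 ge_min lexx orbT.
by exists p => //; apply: packing_mono pE => //; rewrite ge_min lexx.
Qed.

(* If [Phi s A rho < Mlim s A], cover a definite proportion of [E] by disjoint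
   small copies of [A]: this gives covers of [E] of cost uniformly below [Mlim s E]. *)
Lemma Mlim_le_Phi A rho : compact A -> A `<=` E -> (0 < rho)%R -> diam A <= rho%:E ->
  Mlim s A <= Phi s A rho.
Proof.
move=> cA AE rho0 Arho; rewrite leNgt; apply/negP => PhiA.
have Mmono := metric_outer_mono (@Mlim_ge0 R d s) (@Mlim0 R d s) (@Mlim_subadditive R d s).
have fin F : F `<=` E -> Mlim s F \is a fin_num.
  move=> FE; rewrite ge0_fin_numE ?Mlim_ge0//.
  by apply: le_lt_trans attractor_Mlim_lty; exact: Mmono.
have ME0 : 0 < Mlim s E.
  apply: lt_le_trans (Mmono _ _ AE); apply: le_lt_trans PhiA; exact: Phi_ge0.
have [k k0 large] := attractor_packing_large ME0.
have [c /andP[c0 _] copies] := packing_copies S_sim E_attractor D0 ED.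
pose m := fine (Mlim s E); have mE : Mlim s E = m%:E by rewrite fineK// fin.
pose a := fine (Mlim s A); have aE : Mlim s A = a%:E by rewrite fineK// fin.
pose f := fine (Phi s A rho).
have fE : Phi s A rho = f%:E.
  rewrite fineK// ge0_fin_numE ?Phi_ge0//; apply: lt_trans PhiA _.
  by rewrite aE ltry.
have fa : (f < a)%R by rewrite -lte_fin -fE -aE.
(* A lower bound, at every scale, for the sum [w] of the sigma_i^s; the gain k' (a - f) is therefore
   independent of [eta]. *)
pose k' := ((c / (8 * D)) `^ s * k)%R.
have k'0 : (0 < k')%R by rewrite mulr_gt0// powR_gt0// divr_gt0// mulr_gt0.
suff : Mlim s E <= (m - k' * (a - f))%R%:E.
  by rewrite mE lee_fin lerBrDr gerDl leNgt mulr_gt0// subr_gt0.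
apply: Mlim_le => eta eta0.
(* The copies satisfy sigma_i D <= r, so their labels sigma_i rho are at most [eta]. *)
pose r := Num.min D (eta * D / rho)%R.
have r0 : (0 < r)%R by rewrite lt_min D0 divr_gt0// mulr_gt0.
have [p pE kp] := large r r0.
have rD : (r <= D)%R by rewrite ge_min lexx.
have [T [sigma [TE [g g0 sep] sum_sigma sigma_r]]] := copies p r rD pE.
have sig0 i : (0 < sigma i)%R by have [/andP[]] := TE i.
have Tsim i x y : eucl_dist (T i x) (T i y) = (sigma i * eucl_dist x y)%R by have [] := TE i.
have TEE i x : E x -> E (T i x) by have [_ _] := TE i; exact.
pose B i := T i @` A.
have BE i : B i `<=` E by move=> _ [x Ax <-]; apply: TEE; exact: AE.
pose K := \bigcup_i B i.
have KE : K `<=` E by move=> x [i _ /BE].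
have K_closed x : E x -> ~ K x ->
    exists2 g : R, (0 < g)%R & forall y, K y -> (g <= eucl_dist x y)%R.
  move=> Ex Kx.
  have /choice[h hP] : forall i, exists h : R, (0 < h)%R /\
      forall y, B i y -> (h <= eucl_dist x y)%R.
    move=> i; apply: contrapT => none; apply: Kx; exists i => //.
    rewrite ((closure_id (B i)).1 _); last first.
      apply: compact_closed; first exact: rV_hausdorff.
      exact: (@similarity_image_compact R d (T i) (sigma i) (sig0 i) (Tsim i) A cA).
    apply/closure_eucl => e e0; apply: contrapT => far; apply: none.
    exists e; split=> // y By; rewrite leNgt; apply/negP => xy.
    by apply: far; exists y.
  have h0 i : (0 < h i)%R by have [] := hP i.
  have [g' /andP[g'0 _] g'h] := finite_positive_lbound h0.
  exists g' => // y [i _ By]; apply: le_trans (g'h i) _.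
  by have [_] := hP i; apply.
have := metric_outer_split (@Mlim_ge0 R d s) (@Mlim0 R d s) (@Mlim_subadditive R d s)
  (@Mlim_metric R d s) attractor_Mlim_lty KE K_closed.
pose b := fine (Mlim s (E `\` K)).
have bE : Mlim s (E `\` K) = b%:E by rewrite fineK// fin// => x [].
pose w := (\sum_i sigma i `^ s)%R.
(* The measure of the copies is bounded below at the limit, their covering cost above at scale
   [eta]. As b + w a <= m, the cover costs at most b + w f <= m - w (a - f). *)
have MK : (w * a)%R%:E <= Mlim s K.
  apply: (@le_trans _ _ (\sum_i Mlim s (B i))); last first.
    apply: (metric_outer_sum (@Mlim_ge0 R d s) (@Mlim0 R d s) (@Mlim_subadditive R d s)
      (@Mlim_metric R d s) g0) => //.
    - exact: index_enum_uniq.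
    - by move=> i x Bx; exists i.
    - by move=> i j _ _ _ _ ij [x Ax <-] [y Ay <-]; apply: sep => //; exact: AE.
  rewrite mulr_suml -sumEFin; apply: lee_sum => i _.
  by rewrite EFinM -aE; exact: Mlim_image_ge.
have MetaK : Mdelta s eta K <= (w * f)%R%:E.
  apply: (@le_trans _ _ (\sum_i Mdelta s eta (B i))).
    apply: finitely_subadditive.
    - exact: Mdelta_subadditive.
    - exact: Mdelta_ge0.
    - exact: Mdelta0.
    - by move=> x [i _ Bx]; exists i.
  rewrite mulr_suml -sumEFin; apply: lee_sum => i _.
  rewrite EFinM -fE; apply: le_trans (Phi_image_le (sig0 i) (Tsim i) s cA rho0).
  apply: Mdelta_le_Phi1.
    rewrite mulr_gt0//= -ler_pdivlMr// -(ler_pM2r D0).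
    apply: le_trans (sigma_r i) _.
    by rewrite mulrAC ge_min lexx orbT.
  apply: diam_le => [|_ _ [x Ax <-] [y Ay <-]]; first by rewrite ltW// mulr_gt0.
  by rewrite Tsim ler_wpM2l ?(ltW (sig0 i))//; exact: eucl_dist_le_diam Arho Ax Ay.
rewrite bE mE => split_m.
have bwam : (b + w * a <= m)%R.
  by rewrite -lee_fin EFinD; apply: le_trans split_m; rewrite leeD2l.
have k'w : (k' <= w)%R.
  apply: le_trans (sum_sigma s s_ge0); rewrite /k' ler_wpM2l ?powR_ge0//; exact: ltW.
apply: (@le_trans _ _ (b + w * f)%R%:E); last first.
  rewrite lee_fin; have : (k' * (a - f) <= w * (a - f))%R.
    by rewrite ler_wpM2r// subr_ge0 ltW.
  by move: bwam; lra.
have Meta_b : Mdelta s eta (E `\` K) <= b%:E by rewrite -bE; exact: Mdelta_le_Mlim.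
rewrite EFinD; apply: le_trans (leeD Meta_b MetaK); apply: subadditiveU.
- exact: Mdelta_subadditive.
- exact: Mdelta_ge0.
- exact: Mdelta0.
- by move=> x Ex; have [Kx|Kx] := pselect (K x); [right|left].
Qed.

(** Replacing each covering set by the intersection of its closure with E gives a compact subset of
    E with the same label and no greater cost, as [Mlim_le_Phi] requires. *)
Lemma Mlim_le_Minfty : Mlim s E <= Minfty s E.
Proof.
apply: le_ereal_inf_tmp => _ [A [rho [[EA Arho] ->]]].
apply: (@le_trans _ _ (\sum_(0 <= j <oo) Mlim s (E `&` closure (A j)))).
  apply: Mlim_subadditive => x Ex; have [j _ Ax] := EA _ Ex.
  by exists j => //; split=> //; exact: subset_closure.
apply: lee_nneseries => [j _ _|j _]; first exact: Mlim_ge0.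
have [rho0 Ad] := Arho j.
apply: (@le_trans _ _ (Phi s (E `&` closure (A j)) (rho j))); last first.
  by apply: Phi_mono => // x [].
apply: Mlim_le_Phi => //.
- by apply: compact_closedI => //; exact: closed_closure.
- by apply: (diam_mono _ (diam_closure Ad)) => x [].
Qed.

End attractor_measure.

Theorem corollary1p4 (R : realType) (d : nat) (I : finType)
    (S : I -> 'rV[R]_d -> 'rV[R]_d) (E : set 'rV[R]_d)
    (S_sim : forall i, contracting_similarity (S i))
    (E_attractor : is_attractor S E)
    (E_nonsingleton : ~ (exists x, E = [set x])) :
  exists s : R,
    [/\ dimH E = s%:E, dimP E = s%:E, 0 < s,
        (forall delta : R, 0 < delta ->
           Minfty s E = Mdelta s delta E /\ Mdelta s delta E = Mlim s E) &
        (Mlim s E < +oo)%E].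
Proof.
have [_ cE _] := E_attractor.
have [D D0 ED] := compact_eucl_bounded cE.
have dimE_fin : dimH E \is a fin_num.
  by rewrite ge0_fin_numE ?dimH_ge0// (le_lt_trans (dimH_le_ambient cE))// ltry.
pose s := fine (dimH E); have dimE : dimH E = s%:E by rewrite fineK.
have s0 : 0 <= s by rewrite -lee_fin -dimE dimH_ge0.
have Mlim_Minfty := Mlim_le_Minfty S_sim E_attractor D0 ED s0 dimE.
exists s; split => //.
- exact: attractor_dimP S_sim E_attractor D0 ED s0 dimE.
- exact: attractor_dim_gt0 S_sim E_attractor D0 ED dimE E_nonsingleton.
- move=> delta delta0; have MM := Mdelta_le_Mlim s E delta0.
  have infM : (Minfty s E <= Mdelta s delta E)%E.
    by apply: ereal_inf_le_tmp => v [A [rho [Arho _ ->]]]; exists A, rho.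
  split; apply/eqP; rewrite eq_le.
    by rewrite infM (le_trans MM).
  by rewrite MM (le_trans Mlim_Minfty).
- exact: attractor_Mlim_lty S_sim E_attractor D0 ED s0 dimE.
Qed.
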